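(* For complex parameters $\alpha,a,b,c,\beta,\gamma$ with $\max\bigl\{\bigl|\alpha \beta abc/q^2\bigr|, \bigl|\alpha \gamma abc/q^2\bigr|\bigr\}<1$, we have \begin{align*} &\sum_{n=0}^\infty \frac{\bigl(1-\alpha q^{2n}\bigr)(\alpha, q/c; q)_n (c/q)^n}{(1-\alpha)(q, \alpha c; q)_n}\, {}_4 \phi_3 \biggl({{q^{-n}, \alpha q^n, \alpha \beta ab/q, \alpha \gamma ab/q}\atop{\alpha a, \alpha b,\alpha \beta \gamma ab/q}}; q, q\biggr)\\ &\qquad=\frac{\bigl(q\alpha, \alpha ac/q, \alpha bc/q, \alpha \beta ab/q, \alpha \gamma ab/q, \alpha \beta \gamma abc/q^2; q\bigr)_\infty}{\bigl(\alpha a, \alpha b, \alpha c, \alpha \beta abc/q^2, \alpha \gamma abc/q^2, \alpha \beta \gamma ab/q; q \bigr)_\infty}. \end{align*}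
   Context: Throughout, $q$ is a complex number with $0<|q|<1$. For $x\in\mathbb{C}$, $(x;q)_\infty=\prod_{k=0}^\infty(1-xq^k)$ and, for an integer $n\ge 0$, $(x;q)_n=\prod_{k=0}^{n-1}(1-xq^k)$; also $(x_1,\dots,x_m;q)_n=(x_1;q)_n\cdots(x_m;q)_n$ for $n$ an integer or $\infty$. The basic hypergeometric series is ${}_r\phi_s\Bigl({{a_1,\dots,a_r}\atop{b_1,\dots,b_s}};q,z\Bigr)=\sum_{n=0}^\infty \frac{(a_1,\dots,a_r;q)_n}{(q,b_1,\dots,b_s;q)_n}\bigl((-1)^nq^{n(n-1)/2}\bigr)^{1+s-r}z^n$. *)

(* Defs.v *)
From Stdlib Require Import Reals ClassicalEpsilon.
From Coquelicot Require Import Coquelicot.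
Open Scope C_scope.

Fixpoint qpoch (x q : C) (n : nat) : C :=
  match n with
  | O => 1
  | S m => qpoch x q m * (1 - x * Cpow q m)
  end.

(* infinite q-Pochhammer symbol (x;q)_oo : the limit of (x;q)_n
   (chosen by classical choice; it exists and is unique when |q| < 1) *)
Definition qpoch_inf (x q : C) : C :=
  epsilon (inhabits (RtoC 0%R))
    (fun P : C => filterlim (fun n => qpoch x q n) eventually (@locally C_UniformSpace P)).

Definition Csum (u : nat -> C) : C :=
  epsilon (inhabits (RtoC 0%R)) (fun l : C => is_series u l).

(* 4phi3 basic hypergeometric series; here 1+s-r = 0 so the factor
   ((-1)^n q^{n(n-1)/2})^{1+s-r} equals 1 *)
Definition phi43 (a1 a2 a3 a4 b1 b2 b3 q z : C) : C :=
  Csum (fun n =>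
    (qpoch a1 q n * qpoch a2 q n * qpoch a3 q n * qpoch a4 q n)
    / (qpoch q q n * qpoch b1 q n * qpoch b2 q n * qpoch b3 q n)
    * Cpow z n).

(* Main.v *)
Require Import Defs.
From Stdlib Require Import Reals.
From Coquelicot Require Import Coquelicot.
From Stdlib Require Import Lra Lia ClassicalEpsilon.
Open Scope C_scope.

(** Put x = c/q and regard (A, B; q)_k / (C, D, E; q)_k, with A, B the numerator
    and C, D, E the denominator parameters of the 4phi3, as a function sampled at
    the nodes q^k. The n-th 4phi3 is (q;q)_n times a divided difference of
    (alpha q^n; q)_k (A, B; q)_k / (C, D, E; q)_k over 1, q, ..., q^n, and
    (q/c; q)_n (c/q)^n = prod_{i<n} (x - q^i). By induction, the partial sum
    up to n = N is (alpha q; q)_N / (alpha c; q)_N times the Newton interpolation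
    polynomial at x, on the nodes 1, ..., q^N, of
    (A)_k/(C)_k * (B)_k/(D)_k * (alpha q^(N+1))_k/(E)_k,
    whereas the right-hand side is the same multiple of the value at x of the
    interpolated function. It remains to see that the interpolation error tends
    to 0. For a single ratio (A)_k/(C)_k the divided differences are explicit and
    O(r^n) for r >= |A|, and convergence of the Newton series to the function is
    the q-Gauss sum; the Leibniz rule transfers the geometric bounds to the
    product of the three ratios. The hypothesis |A x|, |B x| < 1 leaves room for
    such an r with r |x| < 1. *)

(** * Finite sums of complex numbers *)

Fixpoint psum (u : nat -> C) (n : nat) : C :=
  match n with
  | O => 0
  | S m => psum u m + u m
  end.

Lemma psum_S (u : nat -> C) (n : nat) : psum u (S n) = psum u n + u n.
Proof. reflexivity. Qed.

Lemma psum_ext (u v : nat -> C) (n : nat) :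
  (forall k, (k < n)%nat -> u k = v k) -> psum u n = psum v n.
Proof.
  induction n as [|n IH]; intros H; simpl; [reflexivity|].
  rewrite IH by (intros; apply H; lia). rewrite H by lia. reflexivity.
Qed.

Lemma psum_scal (a : C) (u : nat -> C) (n : nat) :
  psum (fun k => a * u k) n = a * psum u n.
Proof. induction n as [|n IH]; simpl; [ring|]. rewrite IH. ring. Qed.

Lemma psum_plus (u v : nat -> C) (n : nat) :
  psum (fun k => u k + v k) n = psum u n + psum v n.
Proof. induction n as [|n IH]; simpl; [ring|]. rewrite IH. ring. Qed.

Lemma psum_minus (u v : nat -> C) (n : nat) :
  psum (fun k => u k - v k) n = psum u n - psum v n.
Proof. induction n as [|n IH]; simpl; [ring|]. rewrite IH. ring. Qed.

Lemma psum_shift (u : nat -> C) (n : nat) :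
  psum u (S n) = u O + psum (fun k => u (S k)) n.
Proof. induction n as [|n IH]; simpl in *; [ring|]. rewrite IH. ring. Qed.

Lemma psum_telescope (u : nat -> C) (n : nat) :
  psum (fun k => u (S k) - u k) n = u n - u O.
Proof. induction n as [|n IH]; simpl; [ring|]. rewrite IH. ring. Qed.

Lemma sum_n_psum (u : nat -> C) (n : nat) : sum_n u n = psum u (S n).
Proof.
  induction n as [|n IH].
  - rewrite sum_O. simpl. ring.
  - rewrite sum_Sn, IH. reflexivity.
Qed.

Lemma Cmod_psum_le (u : nat -> C) (n : nat) (K : R) :
  (forall k, (k < n)%nat -> (Cmod (u k) <= K)%R) ->
  (Cmod (psum u n) <= INR n * K)%R.
Proof.
  induction n as [|n IH]; intros H.
  - simpl. rewrite Cmod_0. lra.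
  - rewrite S_INR. simpl. eapply Rle_trans; [apply Cmod_triangle|].
    assert (H1 := H n ltac:(lia)).
    assert (H2 := IH ltac:(intros; apply H; lia)). lra.
Qed.

(** * Powers of [q] and finite q-Pochhammer symbols *)

Lemma Cmod_pow_lt_1 (q : C) (n : nat) :
  (Cmod q < 1)%R -> (Cmod (Cpow q (S n)) < 1)%R.
Proof.
  intros Hq. rewrite Cmod_pow. apply pow_lt_1_compat; [|lia].
  split; [apply Cmod_ge_0 | exact Hq].
Qed.

Lemma Cpow_ne_1 (q : C) (n : nat) : (Cmod q < 1)%R -> Cpow q (S n) <> 1.
Proof.
  intros Hq E. assert (H := Cmod_pow_lt_1 q n Hq).
  rewrite E, Cmod_1 in H. lra.
Qed.

Lemma Csub_ne_0 (x y : C) : x <> y -> x - y <> 0.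
Proof.
  intros H E. apply H. replace x with ((x - y) + y) by ring. rewrite E. ring.
Qed.

Lemma Cmult_reg_l (a x y : C) : a <> 0 -> a * x = a * y -> x = y.
Proof.
  intros Ha E. replace x with (a * x / a) by (field; exact Ha).
  rewrite E. field. exact Ha.
Qed.

Lemma node_ne (q : C) (s n : nat) :
  q <> 0 -> (Cmod q < 1)%R -> Cpow q (s + S n) - Cpow q s <> 0.
Proof.
  intros H0 H1. rewrite Cpow_add_r.
  replace (Cpow q s * Cpow q (S n) - Cpow q s)
    with (Cpow q s * (Cpow q (S n) - 1)) by ring.
  apply Cmult_neq_0; [now apply Cpow_nz|].
  now apply Csub_ne_0, Cpow_ne_1.
Qed.

Lemma qpoch_add (x q : C) (m n : nat) :
  qpoch x q (m + n) = qpoch x q m * qpoch (x * Cpow q m) q n.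
Proof.
  induction n as [|n IH].
  - rewrite Nat.add_0_r. simpl. ring.
  - rewrite Nat.add_succ_r. simpl. rewrite IH, Cpow_add_r. ring.
Qed.

Lemma qpoch_S_l (x q : C) (n : nat) :
  qpoch x q (S n) = (1 - x) * qpoch (x * q) q n.
Proof.
  change (S n) with (1 + n)%nat. rewrite qpoch_add. simpl.
  replace (x * (q * 1)) with (x * q) by ring. ring.
Qed.

Lemma qpoch_ne_0 (x q : C) (n : nat) :
  (forall k, x * Cpow q k <> 1) -> qpoch x q n <> 0.
Proof.
  intros H. induction n as [|n IH]; simpl.
  - intros E. injection E. lra.
  - apply Cmult_neq_0; [exact IH|].
    apply Csub_ne_0. intros E. apply (H n). now symmetry.
Qed.

Lemma qpoch_q_ne_0 (q : C) (n : nat) : (Cmod q < 1)%R -> qpoch q q n <> 0.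
Proof. intros Hq. apply qpoch_ne_0. intros k. exact (Cpow_ne_1 q k Hq). Qed.

(** * Divided differences on geometric nodes *)

(* [dd q f n s] is the divided difference over the nodes q^s, ..., q^(s+n) of
   the function taking the value [f k] at q^k. *)
Fixpoint dd (q : C) (f : nat -> C) (n s : nat) : C :=
  match n with
  | O => f s
  | S m => (dd q f m (S s) - dd q f m s) / (Cpow q (s + S m) - Cpow q s)
  end.

Lemma dd_ext (q : C) (f g : nat -> C) (n s : nat) :
  (forall k, f k = g k) -> dd q f n s = dd q g n s.
Proof.
  intros H. revert s. induction n as [|n IH]; intros s; simpl; [apply H|].
  now rewrite !IH.
Qed.

Lemma dd_scal (q a : C) (f : nat -> C) (n s : nat) :
  dd q (fun k => a * f k) n s = a * dd q f n s.
Proof.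
  revert s. induction n as [|n IH]; intros s; simpl; [reflexivity|].
  rewrite !IH. unfold Cdiv. ring.
Qed.

Lemma dd_S_l (q : C) (f : nat -> C) (n s : nat) :
  q <> 0 -> (Cmod q < 1)%R ->
  dd q f n (S s)
  = dd q f n s + (Cpow q (s + S n) - Cpow q s) * dd q f (S n) s.
Proof. intros H0 H1. simpl dd. field. now apply node_ne. Qed.

(** Leibniz rule. The induction multiplies through by the span [q^(s+n+1) - q^s] of the nodes, so
    that only the division-free recursion [dd_S_l] is used. *)
Lemma dd_mul (q : C) (f g : nat -> C) (n s : nat) :
  q <> 0 -> (Cmod q < 1)%R ->
  dd q (fun k => f k * g k) n s
  = psum (fun k => dd q f k s * dd q g (n - k) (s + k)) (S n).
Proof.
  intros H0 H1. revert s. induction n as [|n IH]; intros s.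
  - simpl. rewrite Nat.add_0_r. ring.
  - apply (Cmult_reg_l (Cpow q (s + S n) - Cpow q s)); [now apply node_ne|].
    rewrite <- psum_scal.
    transitivity (dd q (fun k => f k * g k) n (S s)
                  - dd q (fun k => f k * g k) n s).
    { rewrite dd_S_l by assumption. ring. }
    rewrite !IH, <- psum_minus.
    (* Each difference of two products is split by changing one factor at a time, which raises the
       order of either [f] or [g] by one. *)
    transitivity
      (psum (fun k => (Cpow q (s + S n) - Cpow q (s + k))
                        * (dd q f k s * dd q g (S n - k) (s + k))) (S n)
       + psum (fun k => (Cpow q (s + S k) - Cpow q s)
                        * (dd q f (S k) s * dd q g (S n - S k) (s + S k)))
              (S n)).
    { rewrite <- psum_plus. apply psum_ext. intros k Hk.
      rewrite (dd_S_l q f k s) by assumption.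
      replace (S s + k)%nat with (S (s + k)) by lia.
      rewrite (dd_S_l q g (n - k) (s + k)) by assumption.
      replace (s + k + S (n - k))%nat with (s + S n)%nat by lia.
      replace (S n - k)%nat with (S (n - k)) by lia.
      replace (S n - S k)%nat with (n - k)%nat by lia.
      replace (s + S k)%nat with (S (s + k)) by lia.
      rewrite (dd_S_l q g (n - k) (s + k)) by assumption.
      replace (s + k + S (n - k))%nat with (s + S n)%nat by lia.
      ring. }
    symmetry.
    (* The span is split as [(q^(s+n+1) - q^(s+k)) + (q^(s+k) - q^s)]. The first sum has a zero term
       at [k = n + 1], the second at [k = 0]; dropping them and shifting the second index gives the
       two sums above. *)
    transitivity
      (psum (fun k => (Cpow q (s + S n) - Cpow q (s + k))
                        * (dd q f k s * dd q g (S n - k) (s + k))) (S (S n))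
       + psum (fun k => (Cpow q (s + k) - Cpow q s)
                        * (dd q f k s * dd q g (S n - k) (s + k))) (S (S n))).
    { rewrite <- psum_plus. apply psum_ext. intros k Hk. ring. }
    rewrite (psum_shift (fun k => (Cpow q (s + k) - Cpow q s) * _)).
    rewrite (psum_S _ (S n)), Nat.add_0_r. ring.
Qed.

(** * Newton interpolation polynomials *)

Fixpoint nodes (q x : C) (s n : nat) : C :=
  match n with
  | O => 1
  | S m => nodes q x s m * (x - Cpow q (s + m))
  end.

Lemma nodes_S (q x : C) (s n : nat) :
  nodes q x s (S n) = nodes q x s n * (x - Cpow q (s + n)).
Proof. reflexivity. Qed.

Lemma nodes_S_l (q x : C) (s n : nat) :
  nodes q x s (S n) = (x - Cpow q s) * nodes q x (S s) n.
Proof.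
  induction n as [|n IH].
  - simpl. rewrite Nat.add_0_r. ring.
  - change (nodes q x s (S (S n)))
      with (nodes q x s (S n) * (x - Cpow q (s + S n))).
    rewrite IH. replace (s + S n)%nat with (S s + n)%nat by lia. simpl. ring.
Qed.

Lemma nodes_add (q x : C) (s m n : nat) :
  nodes q x s (m + n) = nodes q x s m * nodes q x (s + m) n.
Proof.
  induction n as [|n IH].
  - rewrite Nat.add_0_r. simpl. ring.
  - rewrite Nat.add_succ_r. simpl. rewrite IH.
    rewrite Nat.add_assoc. ring.
Qed.

(** Here [n] counts the nodes, so the interpolation polynomial has degree below [n] and is [0] for
    [n = 0]. *)
Definition newton (q : C) (f : nat -> C) (x : C) (s n : nat) : C :=
  psum (fun k => dd q f k s * nodes q x s k) n.

Lemma newton_ext (q : C) (f g : nat -> C) (x : C) (s n : nat) :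
  (forall k, f k = g k) -> newton q f x s n = newton q g x s n.
Proof.
  intros H. apply psum_ext. intros k _. now rewrite (dd_ext q f g).
Qed.

(** Both sides interpolate on [q^s, ..., q^(s+n)]; the right-hand side takes [q^s] as the last node
    instead of the first. Moving the base node thus costs a single term. *)
Lemma newton_S_l (q : C) (f : nat -> C) (x : C) (s n : nat) :
  q <> 0 -> (Cmod q < 1)%R ->
  newton q f x s (S n)
  = newton q f x (S s) n + dd q f n s * nodes q x (S s) n.
Proof.
  intros H0 H1. induction n as [|n IH].
  - unfold newton. simpl. ring.
  - change (newton q f x s (S (S n)))
      with (newton q f x s (S n) + dd q f (S n) s * nodes q x s (S n)).
    change (newton q f x (S s) (S n))
      with (newton q f x (S s) n + dd q f n (S s) * nodes q x (S s) n).
    rewrite IH, nodes_S_l, (dd_S_l q f n s) by assumption.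
    rewrite nodes_S. replace (s + S n)%nat with (S s + n)%nat by lia. ring.
Qed.

(** By the Leibniz rule, the polynomial of a product is the sum of [dd q f k s * nodes q x s k]
    times the polynomial of [g] on the remaining nodes [q^(s+k), ..., q^(s+n-1)]. Writing the latter
    as [gx] minus an error gives the formula. The number [gx] is arbitrary here; later it is the
    value of [g] off the nodes. *)
Lemma newton_mul (q : C) (f g : nat -> C) (x gx : C) (s n : nat) :
  q <> 0 -> (Cmod q < 1)%R ->
  newton q (fun k => f k * g k) x s n
  = newton q f x s n * gx
    - psum (fun k => dd q f k s * nodes q x s k
                     * (gx - newton q g x (s + k) (n - k))) n.
Proof.
  intros H0 H1. induction n as [|n IH].
  - unfold newton. simpl. ring.
  - change (newton q (fun k => f k * g k) x s (S n))
      with (newton q (fun k => f k * g k) x s n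
            + dd q (fun k => f k * g k) n s * nodes q x s n).
    change (newton q f x s (S n))
      with (newton q f x s n + dd q f n s * nodes q x s n).
    rewrite IH, dd_mul by assumption.
    rewrite !psum_S, Nat.sub_diag.
    replace (S n - n)%nat with 1%nat by lia.
    replace (newton q g x (s + n) 1) with (g (s + n)%nat)
      by (unfold newton; simpl; ring).
    change (dd q g 0 (s + n)) with (g (s + n)%nat).
    transitivity
      (newton q f x s n * gx
       - (psum (fun k => dd q f k s * nodes q x s k
                         * (gx - newton q g x (s + k) (n - k))) n
          - nodes q x s n * psum (fun k => dd q f k s * dd q g (n - k) (s + k)) n)
       + dd q f n s * g (s + n)%nat * nodes q x s n); [ring|].
    rewrite <- psum_scal, <- psum_minus.
    rewrite (psum_ext _ (fun k => dd q f k s * nodes q x s k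
                * (gx - newton q g x (s + k) (S n - k)))); [ring|].
    intros k Hk. rewrite Nat.sub_succ_l by lia.
    change (newton q g x (s + k) (S (n - k)))
      with (newton q g x (s + k) (n - k)
            + dd q g (n - k) (s + k) * nodes q x (s + k) (n - k)).
    replace (nodes q x s n) with (nodes q x s (k + (n - k)))
      by (f_equal; lia).
    rewrite nodes_add. ring.
Qed.

(** For an affine factor the Leibniz rule has two terms. Regrouped by divided differences of [f],
    each order [k < n] collects [(u + v q^k) + v (x - q^k) = u + v x]; only the top order keeps the
    node value [u + v q^n]. *)
Lemma newton_affine (q u v : C) (f : nat -> C) (x : C) (n : nat) :
  q <> 0 -> (Cmod q < 1)%R ->
  newton q (fun k => (u + v * Cpow q k) * f k) x 0 (S n)
  = (u + v * x) * newton q f x 0 n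
    + (u + v * Cpow q n) * dd q f n 0 * nodes q x 0 n.
Proof.
  intros H0 H1.
  assert (Hdd : forall m s, dd q (fun k => (u + v * Cpow q k) * f k) (S m) s
            = (u + v * Cpow q (s + S m)) * dd q f (S m) s + v * dd q f m s).
  { induction m as [|m IH]; intros s.
    - assert (H := node_ne q s 0 H0 H1). simpl. revert H.
      replace (s + 1)%nat with (S s) by lia. simpl. intros H.
      field. exact H.
    - change (dd q (fun k => (u + v * Cpow q k) * f k) (S (S m)) s)
        with ((dd q (fun k => (u + v * Cpow q k) * f k) (S m) (S s)
               - dd q (fun k => (u + v * Cpow q k) * f k) (S m) s)
              / (Cpow q (s + S (S m)) - Cpow q s)).
      rewrite !IH. rewrite (dd_S_l q f (S m) s), (dd_S_l q f m s) by assumption.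
      replace (S s + S m)%nat with (s + S (S m))%nat by lia.
      field. now apply node_ne. }
  induction n as [|n IH].
  - unfold newton. simpl. ring.
  - change (newton q (fun k => (u + v * Cpow q k) * f k) x 0 (S (S n)))
      with (newton q (fun k => (u + v * Cpow q k) * f k) x 0 (S n)
            + dd q (fun k => (u + v * Cpow q k) * f k) (S n) 0
              * nodes q x 0 (S n)).
    change (newton q f x 0 (S n))
      with (newton q f x 0 n + dd q f n 0 * nodes q x 0 n).
    rewrite IH, Hdd, nodes_S, !Nat.add_0_l. ring.
Qed.

(** * Explicit divided differences *)

(** The homogeneous q-Pochhammer symbol, equal to [A^n (B/A; q)_n] for nonzero [A]; being free of
    division, it also covers [A = 0]. *)
Fixpoint hpoch (A B q : C) (n : nat) : C :=
  match n with
  | O => 1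
  | S m => hpoch A B q m * (A - B * Cpow q m)
  end.

Lemma nodes_hpoch (q x : C) (s n : nat) :
  nodes q x s n = hpoch x (Cpow q s) q n.
Proof.
  induction n as [|n IH]; simpl; [reflexivity|].
  now rewrite IH, Cpow_add_r.
Qed.

(** Over a common denominator the recursion leaves [(1 - A q^s) - (1 - B q^(s+n)) = - q^s (A - B
    q^n)], while the node difference is [- q^s (1 - q^(n+1))]; the quotient supplies the next
    factors. *)
Lemma dd_qpoch_ratio (q A B : C) (n s : nat) :
  q <> 0 -> (Cmod q < 1)%R -> (forall k, B * Cpow q k <> 1) ->
  dd q (fun k => qpoch A q k / qpoch B q k) n s
  = qpoch A q s * hpoch A B q n / (qpoch q q n * qpoch B q (s + n)).
Proof.
  intros H0 H1 HB. revert s. induction n as [|n IH]; intros s.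
  - simpl. rewrite Nat.add_0_r. field. now apply qpoch_ne_0.
  - simpl dd. rewrite !IH. simpl qpoch at 1.
    replace (S s + n)%nat with (s + S n)%nat by lia.
    assert (HN := node_ne q s n H0 H1).
    assert (HQ := qpoch_q_ne_0 q n H1).
    assert (HQS := qpoch_q_ne_0 q (S n) H1).
    assert (HBS := qpoch_ne_0 B q (s + S n) HB).
    assert (HBn := qpoch_ne_0 B q (s + n) HB).
    revert HN HQS HBS. rewrite !Nat.add_succ_r. simpl.
    rewrite Cpow_add_r. intros HN HQS HBS.
    field. repeat split; try assumption.
    + intros E; apply HBS; rewrite E; ring.
    + intros E; apply HQS; rewrite E; ring.
Qed.

(** The Lagrange form of the divided difference: on geometric nodes its weights are the coefficients
    of a terminating hypergeometric series. *)
Lemma dd_explicit (q : C) (f : nat -> C) (n s : nat) :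
  q <> 0 -> (Cmod q < 1)%R ->
  Cpow q (s * n) * qpoch q q n * dd q f n s
  = psum (fun k => qpoch (/ Cpow q n) q k / qpoch q q k * Cpow q k * f (s + k)%nat)
         (S n).
Proof.
  intros H0 H1. revert s. induction n as [|n IH]; intros s.
  - simpl. rewrite Nat.mul_0_r, Nat.add_0_r. simpl. field.
  - assert (HN := node_ne q s n H0 H1).
    transitivity (psum (fun k => qpoch (/ Cpow q n) q k / qpoch q q k
                                 * Cpow q k * f (s + k)%nat) (S n)
      - / Cpow q n * psum (fun k => qpoch (/ Cpow q n) q k / qpoch q q k
                                 * Cpow q k * f (S s + k)%nat) (S n)).
    + rewrite <- !IH. simpl dd. rewrite Nat.mul_succ_r, Cpow_add_r.
      replace (S s * n)%nat with (s * n + n)%nat by lia.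
      rewrite !Cpow_add_r. simpl qpoch.
      revert HN. rewrite !Cpow_add_r. simpl. intros HN.
      field. split; [|exact HN]. now apply Cpow_nz.
    + set (c := fun k => qpoch (/ Cpow q n) q k / qpoch q q k * Cpow q k).
      (* Since [(q^(-n); q)_(n+1) = 0], the sum of order [n] may be lengthened by one term to match
         order [n + 1]. *)
      assert (Hlast : c (S n) = 0).
      { unfold c. change (qpoch (/ Cpow q n) q (S n))
          with (qpoch (/ Cpow q n) q n * (1 - / Cpow q n * Cpow q n)).
        rewrite Cinv_l by now apply Cpow_nz. unfold Cdiv. ring. }
      rewrite (psum_shift (fun k => qpoch (/ Cpow q (S n)) q k / _ * _ * _)).
      transitivity (psum (fun k => c k * f (s + k)%nat) (S (S n))
        - / Cpow q n * psum (fun k => c k * f (S s + k)%nat) (S n)).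
      { change (psum (fun k => c k * f (s + k)%nat) (S (S n)))
          with (psum (fun k => c k * f (s + k)%nat) (S n)
                + c (S n) * f (s + S n)%nat).
        rewrite Hlast. unfold c. ring. }
      rewrite psum_shift, <- psum_scal.
      transitivity (c O * f (s + 0)%nat
         + (psum (fun k => c (S k) * f (s + S k)%nat) (S n)
            - psum (fun k => / Cpow q n * (c k * f (S s + k)%nat)) (S n)));
        [ring|].
      (* What remains is a q-Pascal rule: the weights of order [n + 1] are
         [c (S k) - q^(-n) c k]. *)
      rewrite <- psum_minus. f_equal. apply psum_ext. intros k _.
      replace (s + S k)%nat with (S s + k)%nat by lia.
      replace (qpoch (/ Cpow q (S n)) q (S k))
        with ((1 - / Cpow q (S n)) * qpoch (/ Cpow q n) q k).
      2:{ rewrite qpoch_S_l. f_equal. f_equal. simpl. field.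
          split; [now apply Cpow_nz | exact H0]. }
      unfold c. assert (HQ := qpoch_q_ne_0 q (S k) H1).
      assert (HQ' := qpoch_q_ne_0 q k H1).
      simpl in HQ |- *.
      assert (HQ1 : 1 - q * Cpow q k <> 0) by (intros E; apply HQ; rewrite E; ring).
      assert (HQ2 : Cpow q n <> 0) by now apply Cpow_nz.
      field. now repeat split.
Qed.

(** * Partial sums of the outer series *)

(** From [N] to [N + 1] the interpolated function changes by [(1 - alpha q^(N+1) q^k) (alpha
    q^(N+1); q)_k = (1 - alpha q^(N+1)) (alpha q^(N+2); q)_k]. So [newton_affine] applies with
    [u = 1] and [v = - alpha q^(N+1)]: then [u + v x] is the new factor of [(alpha q x; q)_(N+1)],
    and [u + v q^(N+1)] is the very-well-poised factor [1 - alpha q^(2N+2)]. *)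
Lemma psum_very_well_poised (q alpha x : C) (h : nat -> C) (N : nat) :
  q <> 0 -> (Cmod q < 1)%R -> alpha <> 1 ->
  (forall k, alpha * q * x * Cpow q k <> 1) ->
  psum (fun n =>
    (1 - alpha * Cpow q (2 * n)) * qpoch alpha q n * nodes q x 0 n
    / ((1 - alpha) * qpoch (alpha * q * x) q n)
    * dd q (fun k => qpoch (alpha * Cpow q n) q k * h k) n 0) (S N)
  * qpoch (alpha * q * x) q N
  = qpoch (alpha * q) q N
    * newton q (fun k => qpoch (alpha * Cpow q (S N)) q k * h k) x 0 (S N).
Proof.
  intros H0 H1 Ha Hx.
  assert (Ha' : 1 - alpha <> 0).
  { apply Csub_ne_0. intros E. now apply Ha. }
  induction N as [|N IH].
  - unfold newton. simpl. field. exact Ha'.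
  - rewrite psum_S, Cmult_plus_distr_r.
    assert (HN := qpoch_ne_0 _ q (S N) Hx).
    change (qpoch (alpha * q * x) q (S N)) with
      (qpoch (alpha * q * x) q N * (1 - alpha * q * x * Cpow q N)) at 1.
    rewrite Cmult_assoc, IH.
    set (F := fun k => qpoch (alpha * Cpow q (S N)) q k * h k).
    assert (E : newton q (fun k => (1 + - (alpha * Cpow q (S N)) * Cpow q k) * F k)
                  x 0 (S (S N))
       = (1 - alpha * Cpow q (S N))
         * newton q (fun k => qpoch (alpha * Cpow q (S (S N))) q k * h k) x 0 (S (S N))).
    { unfold newton at 2. rewrite <- psum_scal. apply psum_ext. intros m _.
      rewrite (dd_ext q _ (fun k => (1 - alpha * Cpow q (S N)) *
         (qpoch (alpha * Cpow q (S (S N))) q k * h k))).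
      - rewrite dd_scal. ring.
      - intros k. unfold F.
        transitivity (qpoch (alpha * Cpow q (S N)) q (S k) * h k);
          [simpl; ring|].
        rewrite qpoch_S_l.
        replace (alpha * Cpow q (S N) * q) with (alpha * Cpow q (S (S N)))
          by (simpl; ring).
        ring. }
    rewrite newton_affine in E by assumption.
    rewrite (qpoch_S_l alpha q N).
    change (qpoch (alpha * q) q (S N))
      with (qpoch (alpha * q) q N * (1 - alpha * q * Cpow q N)).
    transitivity (qpoch (alpha * q) q N *
      ((1 - alpha * Cpow q (S N)) *
         newton q (fun k => qpoch (alpha * Cpow q (S (S N))) q k * h k) x 0 (S (S N)))).
    2:{ simpl Cpow. ring. }
    rewrite <- E.
    replace (Cpow q (2 * S N)) with (Cpow q (S N) * Cpow q (S N)).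
    2:{ rewrite <- Cpow_add_r. f_equal. lia. }
    fold F.
    replace (1 + - (alpha * Cpow q (S N)) * x)
      with (1 - alpha * q * x * Cpow q N) by (simpl; ring).
    field. now split.
Qed.

(** * Limits of complex sequences *)

(** Stated through moduli so that limit theorems for real sequences apply; [Clim_filterlim] and
    [is_series_Clim] connect it with filter limits and series. *)
Definition Clim (u : nat -> C) (l : C) : Prop :=
  is_lim_seq (fun n => Cmod (u n - l)) 0%R.

Lemma Clim_le (u : nat -> C) (l : C) (b : nat -> R) :
  (forall n, (Cmod (u n - l) <= b n)%R) -> is_lim_seq b 0%R -> Clim u l.
Proof.
  intros H Hb. apply is_lim_seq_le_le with (fun _ => 0%R) b.
  - intros n. split; [apply Cmod_ge_0 | apply H].
  - apply is_lim_seq_const.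
  - exact Hb.
Qed.

Lemma Clim_ext (u v : nat -> C) (l : C) :
  (forall n, u n = v n) -> Clim u l -> Clim v l.
Proof.
  intros H. apply is_lim_seq_ext. intros n. now rewrite H.
Qed.

Lemma Clim_const (l : C) : Clim (fun _ => l) l.
Proof.
  apply Clim_le with (fun _ => 0%R); [|apply is_lim_seq_const].
  intros n. replace (l - l) with (RtoC 0) by ring. rewrite Cmod_0. lra.
Qed.

Lemma Clim_plus (u v : nat -> C) (l m : C) :
  Clim u l -> Clim v m -> Clim (fun n => u n + v n) (l + m).
Proof.
  intros Hu Hv.
  apply Clim_le with (fun n => Cmod (u n - l) + Cmod (v n - m))%R.
  - intros n. replace (u n + v n - (l + m)) with ((u n - l) + (v n - m)) by ring.
    apply Cmod_triangle.
  - replace 0%R with (0 + 0)%R by ring. now apply is_lim_seq_plus'.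
Qed.

Lemma Cmod_le_sub (a b : C) : (Cmod a <= Cmod b + Cmod (a - b))%R.
Proof.
  replace a with (b + (a - b)) at 1 by ring. apply Cmod_triangle.
Qed.

Lemma Clim_mult (u v : nat -> C) (l m : C) :
  Clim u l -> Clim v m -> Clim (fun n => u n * v n) (l * m).
Proof.
  intros Hu Hv.
  apply Clim_le with (fun n => Cmod (u n - l) * Cmod (v n - m)
    + (Cmod (u n - l) * Cmod m + Cmod l * Cmod (v n - m)))%R.
  - intros n.
    replace (u n * v n - l * m)
      with ((u n - l) * (v n - m) + ((u n - l) * m + l * (v n - m))) by ring.
    eapply Rle_trans; [apply Cmod_triangle|]. rewrite Cmod_mult.
    apply Rplus_le_compat_l. eapply Rle_trans; [apply Cmod_triangle|].
    rewrite !Cmod_mult. lra.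
  - replace 0%R with (0 * 0 + (0 * Cmod m + Cmod l * 0))%R by ring.
    repeat first [apply is_lim_seq_plus' | apply is_lim_seq_mult'];
      try assumption; apply is_lim_seq_const.
Qed.

Lemma Clim_inv (u : nat -> C) (l : C) (K : R) :
  l <> 0 -> (forall n, u n <> 0) -> (forall n, (/ Cmod (u n) <= K)%R) ->
  Clim u l -> Clim (fun n => / u n) (/ l).
Proof.
  intros Hl Hu HK H.
  apply Clim_le with (fun n => K * (Cmod (u n - l) * / Cmod l))%R.
  - intros n. replace (/ u n - / l) with (- (/ u n * ((u n - l) * / l))).
    2:{ field. now split. }
    rewrite Cmod_opp, !Cmod_mult, !Cmod_inv by auto.
    apply Rmult_le_compat_r; [|apply HK].
    apply Rmult_le_pos; [apply Cmod_ge_0|].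
    apply Rlt_le, Rinv_0_lt_compat. now apply Cmod_gt_0.
  - replace 0%R with (K * (0 * / Cmod l))%R by ring.
    repeat apply is_lim_seq_mult'; try assumption; apply is_lim_seq_const.
Qed.

Lemma Clim_unique (u : nat -> C) (l m : C) : Clim u l -> Clim u m -> l = m.
Proof.
  intros Hl Hm.
  assert (H : is_lim_seq (fun _ => Cmod (l - m)) 0%R).
  { apply is_lim_seq_le_le with (fun _ => 0%R)
      (fun n => Cmod (u n - l) + Cmod (u n - m))%R.
    - intros n. split; [apply Cmod_ge_0|].
      replace (l - m) with (- (u n - l) + (u n - m)) by ring.
      rewrite <- (Cmod_opp (u n - l)). apply Cmod_triangle.
    - apply is_lim_seq_const.
    - replace 0%R with (0 + 0)%R by ring. now apply is_lim_seq_plus'. }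
  apply is_lim_seq_unique in H. rewrite Lim_seq_const in H.
  injection H as H. apply Cmod_eq_0 in H.
  replace l with ((l - m) + m) by ring. rewrite H. ring.
Qed.

Lemma Clim_shift (u : nat -> C) (l : C) (n : nat) :
  Clim u l <-> Clim (fun k => u (n + k)%nat) l.
Proof.
  unfold Clim. rewrite (is_lim_seq_incr_n (fun k => Cmod (u k - l)) n).
  split; apply is_lim_seq_ext; intros k; now rewrite Nat.add_comm.
Qed.

Lemma Clim_psum (u : nat -> nat -> C) (l : nat -> C) (n : nat) :
  (forall k, (k < n)%nat -> Clim (fun m => u m k) (l k)) ->
  Clim (fun m => psum (u m) n) (psum l n).
Proof.
  induction n as [|n IH]; intros H; simpl; [apply Clim_const|].
  apply Clim_plus; [apply IH; intros; apply H; lia | apply H; lia].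
Qed.

Lemma Clim_filterlim (u : nat -> C) (l : C) :
  Clim u l <-> filterlim u eventually (@locally C_UniformSpace l).
Proof.
  split.
  - intros H. apply filterlim_locally. intros eps.
    apply is_lim_seq_spec in H. destruct (H eps) as [N HN].
    exists N. intros n Hn. apply C_NormedModule_mixin_compat1.
    specialize (HN n Hn). rewrite Rminus_0_r, Rabs_pos_eq in HN by apply Cmod_ge_0.
    exact HN.
  - intros H. apply is_lim_seq_spec. intros eps.
    (* A ball of [C] bounds the two coordinates separately, so passing to the modulus costs a factor
       [sqrt 2]. *)
    assert (Hs : (0 < sqrt 2)%R) by (apply sqrt_lt_R0; lra).
    assert (He : (0 < eps / sqrt 2)%R).
    { apply Rdiv_lt_0_compat; [apply cond_pos | exact Hs]. }
    destruct (proj1 (filterlim_locally u l) H (mkposreal _ He)) as [N HN].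
    exists N. intros n Hn. specialize (HN n Hn).
    apply C_NormedModule_mixin_compat2 in HN. simpl in HN.
    rewrite Rminus_0_r, Rabs_pos_eq by apply Cmod_ge_0.
    replace (pos eps) with (sqrt 2 * (eps / sqrt 2))%R by (field; lra).
    exact HN.
Qed.

Lemma is_series_Clim (u : nat -> C) (l : C) :
  is_series u l <-> Clim (psum u) l.
Proof.
  rewrite (Clim_shift (psum u) l 1), Clim_filterlim.
  split; apply filterlim_ext; intros n; [|symmetry]; apply sum_n_psum.
Qed.

Lemma Clim_geometric (u : nat -> C) (K p : R) :
  (0 <= p < 1)%R ->
  (forall n, (Cmod (u (S n) - u n) <= K * p ^ n)%R) ->
  exists l, Clim u l.
Proof.
  intros Hp H.
  destruct (@ex_series_le C_AbsRing C_CompleteNormedModule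
              (fun n => u (S n) - u n) (fun n => K * p ^ n)%R) as [l Hl].
  - exact H.
  - apply (@ex_series_scal R_AbsRing R_NormedModule K (fun n => p ^ n)%R).
    apply ex_series_geom. rewrite Rabs_pos_eq; lra.
  - exists (l + u O).
    apply (is_series_Clim (fun n => u (S n) - u n)) in Hl.
    apply Clim_ext with (fun n => psum (fun n => u (S n) - u n) n + u O).
    + intros n. rewrite psum_telescope. ring.
    + apply Clim_plus; [exact Hl | apply Clim_const].
Qed.

Lemma Clim_geometric_rate (u : nat -> C) (l : C) (K p : R) (n : nat) :
  (0 <= p < 1)%R ->
  (forall n, (Cmod (u (S n) - u n) <= K * p ^ n)%R) ->
  Clim u l ->
  (Cmod (l - u n) <= K / (1 - p) * p ^ n)%R.
Proof.
  intros Hp H Hl.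
  assert (HK : (0 <= K)%R).
  { specialize (H O). simpl in H. assert (H' := Cmod_ge_0 (u 1%nat - u O)). lra. }
  (* The factor [1 - p^m] of the finite geometric sum is what lets the induction close. *)
  assert (Hm : forall m, (Cmod (u (n + m)%nat - u n)
                          <= K / (1 - p) * p ^ n * (1 - p ^ m))%R).
  { induction m as [|m IH].
    - rewrite Nat.add_0_r. replace (u n - u n) with (RtoC 0) by ring.
      rewrite Cmod_0. simpl. lra.
    - rewrite Nat.add_succ_r.
      replace (u (S (n + m)) - u n)
        with ((u (S (n + m)) - u (n + m)%nat) + (u (n + m)%nat - u n)) by ring.
      eapply Rle_trans; [apply Cmod_triangle|].
      specialize (H (n + m)%nat). rewrite pow_add in H.
      replace (K / (1 - p) * p ^ n * (1 - p ^ S m))%R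
        with (K * (p ^ n * p ^ m) + K / (1 - p) * p ^ n * (1 - p ^ m))%R.
      2:{ simpl. field. lra. }
      lra. }
  assert (Hpn : (0 <= K / (1 - p) * p ^ n)%R).
  { apply Rmult_le_pos; [|apply pow_le; lra].
    apply Rmult_le_pos; [exact HK|]. apply Rlt_le, Rinv_0_lt_compat. lra. }
  apply (Clim_shift u l n) in Hl.
  assert (HH := is_lim_seq_le (fun m => Cmod (l - u n) - Cmod (u (n + m)%nat - l))%R
           (fun _ => K / (1 - p) * p ^ n)%R
           (Cmod (l - u n) - 0)%R (K / (1 - p) * p ^ n)%R).
  simpl in HH. enough (Cmod (l - u n) - 0 <= K / (1 - p) * p ^ n)%R by lra.
  apply HH.
  - intros m. specialize (Hm m).
    assert (T := Cmod_le_sub (l - u n) (u (n + m)%nat - u n)).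
    replace (l - u n - (u (n + m)%nat - u n)) with (- (u (n + m)%nat - l)) in T by ring.
    rewrite Cmod_opp in T.
    assert (0 <= p ^ m)%R by (apply pow_le; lra).
    assert (0 <= K / (1 - p) * p ^ n * p ^ m)%R by now apply Rmult_le_pos.
    lra.
  - apply is_lim_seq_minus'; [apply is_lim_seq_const | exact Hl].
  - apply is_lim_seq_const.
Qed.

(** * Bounds and limits of q-Pochhammer symbols *)

(** Each factor is at most [r (1 + |B|/r |q|^k) <= r exp (|B|/r |q|^k)], and the exponents form a
    geometric series. Using [r] in place of [|A|] covers [A = 0] and makes the bound uniform in
    [A]. *)
Lemma Cmod_hpoch_le (A B q : C) (r : R) (n : nat) :
  (Cmod q < 1)%R -> (0 < r)%R -> (Cmod A <= r)%R ->
  (Cmod (hpoch A B q n) <= exp (Cmod B / r / (1 - Cmod q)) * r ^ n)%R.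
Proof.
  intros Hq Hr HA. set (p := Cmod q) in *. set (M := (Cmod B / r)%R).
  assert (Hp : (0 <= p)%R) by apply Cmod_ge_0.
  assert (HM : (0 <= M)%R).
  { apply Rmult_le_pos; [apply Cmod_ge_0|]. now apply Rlt_le, Rinv_0_lt_compat. }
  assert (H : (Cmod (hpoch A B q n)
               <= exp (M / (1 - p) * (1 - p ^ n)) * r ^ n)%R).
  { induction n as [|n IH].
    - simpl. rewrite Cmod_1, Rminus_diag, Rmult_0_r, exp_0. lra.
    - simpl hpoch. rewrite Cmod_mult.
      replace (exp (M / (1 - p) * (1 - p ^ S n)) * r ^ S n)%R
        with (exp (M / (1 - p) * (1 - p ^ n)) * r ^ n * (exp (M * p ^ n) * r))%R.
      2:{ replace (M / (1 - p) * (1 - p ^ S n))%R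
            with (M / (1 - p) * (1 - p ^ n) + M * p ^ n)%R
            by (simpl; field; lra).
          rewrite exp_plus. simpl. ring. }
      apply Rmult_le_compat; try apply Cmod_ge_0; [exact IH|].
      unfold Cminus. eapply Rle_trans; [apply Cmod_triangle|].
      rewrite Cmod_opp, Cmod_mult, Cmod_pow. fold p.
      assert (HE := exp_ineq1_le (M * p ^ n)).
      apply Rle_trans with ((1 + M * p ^ n) * r)%R.
      + replace ((1 + M * p ^ n) * r)%R with (r + Cmod B * p ^ n)%R
          by (unfold M; field; lra). lra.
      + apply Rmult_le_compat_r; lra. }
  eapply Rle_trans; [exact H|].
  apply Rmult_le_compat_r; [apply pow_le; lra|].
  assert (HD : (0 <= M / (1 - p))%R).
  { apply Rmult_le_pos; [exact HM|]. apply Rlt_le, Rinv_0_lt_compat. lra. }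
  assert (Hpn : (0 <= p ^ n)%R) by now apply pow_le.
  assert (HE : (M / (1 - p) * (1 - p ^ n) <= M / (1 - p))%R).
  { assert (0 <= M / (1 - p) * p ^ n)%R by now apply Rmult_le_pos. lra. }
  destruct HE as [HE|HE]; [left; now apply exp_increasing | rewrite HE; lra].
Qed.

Lemma qpoch_hpoch (x q : C) (n : nat) : qpoch x q n = hpoch 1 x q n.
Proof. induction n as [|n IH]; simpl; [reflexivity|]. now rewrite IH. Qed.

Lemma Cmod_qpoch_le (x q : C) (n : nat) :
  (Cmod q < 1)%R -> (Cmod (qpoch x q n) <= exp (Cmod x / (1 - Cmod q)))%R.
Proof.
  intros Hq. rewrite qpoch_hpoch.
  assert (H := Cmod_hpoch_le 1 x q 1 n Hq Rlt_0_1).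
  rewrite Cmod_1, pow1, Rmult_1_r, Rdiv_1_r in H. apply H. lra.
Qed.

Lemma Clim_qpoch (x q : C) :
  (Cmod q < 1)%R -> Clim (qpoch x q) (qpoch_inf x q).
Proof.
  intros Hq. apply Clim_filterlim. unfold qpoch_inf.
  apply epsilon_spec.
  destruct (Clim_geometric (qpoch x q)
    (exp (Cmod x / (1 - Cmod q)) * Cmod x) (Cmod q)) as [l Hl].
  - split; [apply Cmod_ge_0 | exact Hq].
  - intros n. simpl.
    replace (qpoch x q n * (1 - x * Cpow q n) - qpoch x q n)
      with (- (qpoch x q n * x * Cpow q n)) by ring.
    rewrite Cmod_opp, !Cmod_mult, Cmod_pow.
    apply Rmult_le_compat_r; [apply pow_le, Cmod_ge_0|].
    apply Rmult_le_compat_r; [apply Cmod_ge_0|]. now apply Cmod_qpoch_le.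
  - exists l. now apply Clim_filterlim.
Qed.

Lemma qpoch_inf_split (x q : C) (n : nat) :
  (Cmod q < 1)%R ->
  qpoch_inf x q = qpoch x q n * qpoch_inf (x * Cpow q n) q.
Proof.
  intros Hq. apply Clim_unique with (fun k => qpoch x q (n + k)).
  - apply (Clim_shift (qpoch x q)). now apply Clim_qpoch.
  - apply Clim_ext with (fun k => qpoch x q n * qpoch (x * Cpow q n) q k).
    + intros k. now rewrite qpoch_add.
    + apply Clim_mult; [apply Clim_const | now apply Clim_qpoch].
Qed.

(** A product of factors [1 - t_k] is at least [1 - sum t_k]; here [t_k = |x| |q|^k], with total at
    most [1/2]. *)
Lemma Cmod_qpoch_ge (x q : C) (n : nat) :
  (Cmod q < 1)%R -> (Cmod x / (1 - Cmod q) <= 1 / 2)%R ->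
  (1 / 2 <= Cmod (qpoch x q n))%R.
Proof.
  intros Hq Hx. set (p := Cmod q) in *. set (M := (Cmod x / (1 - p))%R) in *.
  assert (Hp : (0 <= p)%R) by apply Cmod_ge_0.
  assert (Hx0 := Cmod_ge_0 x).
  assert (HM : (0 <= M)%R).
  { apply Rmult_le_pos; [exact Hx0|]. apply Rlt_le, Rinv_0_lt_compat. lra. }
  assert (H : (1 - M * (1 - p ^ n) <= Cmod (qpoch x q n))%R).
  { induction n as [|n IH].
    - simpl. rewrite Cmod_1. lra.
    - simpl qpoch. rewrite Cmod_mult.
      assert (Hpn : (0 <= p ^ n)%R) by now apply pow_le.
      assert (Hpn1 : (p ^ n <= 1)%R).
      { rewrite <- (pow1 n). apply pow_incr. lra. }
      assert (Ht : (1 - Cmod x * p ^ n <= Cmod (1 - x * Cpow q n))%R).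
      { assert (T := Cmod_le_sub 1 (1 - x * Cpow q n)).
        replace (1 - (1 - x * Cpow q n)) with (x * Cpow q n) in T by ring.
        rewrite Cmod_1, Cmod_mult, Cmod_pow in T. fold p in T. lra. }
      assert (Hxp : (Cmod x = M * (1 - p))%R) by (unfold M; field; lra).
      assert (Hxn : (0 <= Cmod x * p ^ n)%R) by now apply Rmult_le_pos.
      assert (HMn : (0 <= M * (1 - p ^ n))%R) by (apply Rmult_le_pos; lra).
      assert (Hx1 : (Cmod x * p ^ n <= 1)%R) by nra.
      apply Rle_trans with ((1 - M * (1 - p ^ n)) * (1 - Cmod x * p ^ n))%R.
      + replace (M * (1 - p ^ S n))%R
          with (M * (1 - p ^ n) + Cmod x * p ^ n)%R by (rewrite Hxp; simpl; ring).
        nra.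
      + apply Rmult_le_compat; nra. }
  assert (Hpn : (0 <= p ^ n)%R) by now apply pow_le. nra.
Qed.

(** For some [N], [x q^N] is small enough for [Cmod_qpoch_ge]; the first [N] factors contribute only
    a constant. *)
Lemma qpoch_inv_bounded (x q : C) :
  (Cmod q < 1)%R -> (forall k, x * Cpow q k <> 1) ->
  exists K, (0 < K)%R /\ forall n, (/ Cmod (qpoch x q n) <= K)%R.
Proof.
  intros Hq Hx.
  assert (Hp : (0 <= Cmod q)%R) by apply Cmod_ge_0.
  assert (HN : exists N, (Cmod (x * Cpow q N) / (1 - Cmod q) <= 1 / 2)%R).
  { assert (HL : is_lim_seq (fun n => Cmod x * Cmod q ^ n / (1 - Cmod q))%R 0%R).
    { replace 0%R with (Cmod x * 0 * / (1 - Cmod q))%R by ring.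
      repeat apply is_lim_seq_mult'; try apply is_lim_seq_const.
      apply is_lim_seq_geom. rewrite Rabs_pos_eq; lra. }
    apply is_lim_seq_spec in HL.
    assert (Hh : (0 < 1 / 2)%R) by lra.
    destruct (HL (mkposreal _ Hh)) as [N HN]. exists N.
    specialize (HN N (le_n N)). simpl in HN. rewrite Rminus_0_r in HN.
    rewrite Cmod_mult, Cmod_pow.
    assert (T := Rle_abs (Cmod x * Cmod q ^ N / (1 - Cmod q))). lra. }
  destruct HN as [N HN].
  assert (HxN := qpoch_ne_0 x q N Hx).
  assert (HxN' : (0 < Cmod (qpoch x q N))%R) by now apply Cmod_gt_0.
  exists (exp (Cmod x / (1 - Cmod q)) * (/ Cmod (qpoch x q N) * 2))%R. split.
  { apply Rmult_lt_0_compat; [apply exp_pos|].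
    apply Rmult_lt_0_compat; [now apply Rinv_0_lt_compat | lra]. }
  intros n.
  assert (Hn : (0 < Cmod (qpoch x q n))%R) by now apply Cmod_gt_0, qpoch_ne_0.
  assert (Hlow := Cmod_qpoch_ge (x * Cpow q N) q n Hq HN).
  (* Both sides are the modulus of [(x; q)_(n+N)]. This relates [(x; q)_n] to the product bounded
     below, without a case split on [n < N]. *)
  assert (E : (Cmod (qpoch x q n) * Cmod (qpoch (x * Cpow q n) q N)
            = Cmod (qpoch x q N) * Cmod (qpoch (x * Cpow q N) q n))%R).
  { rewrite <- !Cmod_mult, <- !qpoch_add. now rewrite Nat.add_comm. }
  assert (Hup : (Cmod (qpoch (x * Cpow q n) q N)
                 <= exp (Cmod x / (1 - Cmod q)))%R).
  { eapply Rle_trans; [now apply Cmod_qpoch_le|].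
    assert (Hle : (Cmod (x * Cpow q n) / (1 - Cmod q) <= Cmod x / (1 - Cmod q))%R).
    { apply Rmult_le_compat_r; [apply Rlt_le, Rinv_0_lt_compat; lra|].
      rewrite Cmod_mult, Cmod_pow.
      assert (Cmod q ^ n <= 1)%R by (rewrite <- (pow1 n); apply pow_incr; lra).
      assert (T := Cmod_ge_0 x). nra. }
    destruct Hle as [Hle|Hle]; [left; now apply exp_increasing | rewrite Hle; lra]. }
  set (a := Cmod (qpoch x q n)) in *. set (b := Cmod (qpoch x q N)) in *.
  set (u := Cmod (qpoch (x * Cpow q n) q N)) in *.
  set (v := Cmod (qpoch (x * Cpow q N) q n)) in *.
  replace (/ a)%R with (u * (/ b * / v))%R.
  2:{ replace v with (a * u / b)%R by (rewrite E; field; lra).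
      assert (u <> 0)%R by (intros Eu; rewrite Eu in E; nra).
      field. repeat split; try assumption; lra. }
  apply Rmult_le_compat; [apply Cmod_ge_0| |exact Hup|].
  - apply Rmult_le_pos; apply Rlt_le, Rinv_0_lt_compat; lra.
  - apply Rmult_le_compat_l; [apply Rlt_le, Rinv_0_lt_compat; lra|].
    replace 2%R with (/ (1 / 2))%R by lra. apply Rinv_le_contravar; lra.
Qed.

Lemma qpoch_inf_ne_0 (x q : C) :
  (Cmod q < 1)%R -> (forall k, x * Cpow q k <> 1) -> qpoch_inf x q <> 0.
Proof.
  intros Hq Hx E.
  destruct (qpoch_inv_bounded x q Hq Hx) as [K [HK HB]].
  assert (H := Clim_qpoch x q Hq). rewrite E in H.
  assert (T := Rinv_0_lt_compat K HK).
  assert (HL := is_lim_seq_le (fun _ => / K)%R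
                  (fun n => Cmod (qpoch x q n - 0)) (/ K)%R 0%R).
  simpl in HL. enough (/ K <= 0)%R by lra. apply HL; [| |exact H].
  - intros n. replace (qpoch x q n - 0) with (qpoch x q n) by ring.
    rewrite <- (Rinv_inv (Cmod (qpoch x q n))).
    apply Rinv_le_contravar; [|apply HB].
    apply Rinv_0_lt_compat. now apply Cmod_gt_0, qpoch_ne_0.
  - apply is_lim_seq_const.
Qed.

Lemma Clim_qpoch_inv (x q : C) :
  (Cmod q < 1)%R -> (forall k, x * Cpow q k <> 1) ->
  Clim (fun n => / qpoch x q n) (/ qpoch_inf x q).
Proof.
  intros Hq Hx. destruct (qpoch_inv_bounded x q Hq Hx) as [K [_ HB]].
  apply Clim_inv with K; [now apply qpoch_inf_ne_0 | | exact HB | now apply Clim_qpoch].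
  intros n. now apply qpoch_ne_0.
Qed.

(** * The q-Gauss sum *)

Lemma hpoch_scal (t A B q : C) (n : nat) :
  hpoch (A * t) (B * t) q n = Cpow t n * hpoch A B q n.
Proof. induction n as [|n IH]; simpl; [ring|]. rewrite IH. ring. Qed.

(** For nonzero [A] and [x] these are the terms of [2phi1 (B/A, 1/x; B; q, A x)], the series that
    the q-Gauss sum evaluates. *)
Lemma newton_qpoch_ratio (q A B x : C) (n : nat) :
  q <> 0 -> (Cmod q < 1)%R -> (forall k, B * Cpow q k <> 1) ->
  newton q (fun k => qpoch A q k / qpoch B q k) x 0 n
  = psum (fun k => hpoch A B q k * nodes q x 0 k / (qpoch q q k * qpoch B q k)) n.
Proof.
  intros H0 H1 HB. apply psum_ext. intros k _.
  rewrite dd_qpoch_ratio by assumption. simpl.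
  field. split; [now apply qpoch_ne_0 | now apply qpoch_q_ne_0].
Qed.

Lemma shifted_ne_1 (q B : C) (m : nat) :
  (forall k, B * Cpow q k <> 1) -> forall k, B * Cpow q m * Cpow q k <> 1.
Proof.
  intros H k. rewrite <- Cmult_assoc, <- Cpow_add_r. apply H.
Qed.

Lemma one_sub_ne_0 (y : C) : y <> 1 -> 1 - y <> 0.
Proof. intros H. apply Csub_ne_0. intros E. now apply H. Qed.

(** The contiguous relation between [(A, B)] and [(A q, B q)] for truncated sums; the right-hand
    side is the boundary term of a telescoping sum. *)
Lemma newton_ratio_contiguous (q A B x : C) (n : nat) :
  q <> 0 -> (Cmod q < 1)%R -> (forall k, B * Cpow q k <> 1) ->
  (1 - B) * (1 - A * x)
    * newton q (fun k => qpoch A q k / qpoch B q k) x 0 n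
  - (1 - A) * (1 - B * x)
    * newton q (fun k => qpoch (A * q) q k / qpoch (B * q) q k) x 0 n
  = - (hpoch A B q n * nodes q x 0 n * (1 - Cpow q n) * (1 - B * Cpow q n)
       / (qpoch q q n * qpoch (B * q) q n)).
Proof.
  intros H0 H1 HB.
  assert (HBq : forall k, B * q * Cpow q k <> 1).
  { intros k. replace (B * q * Cpow q k) with (B * Cpow q (S k)) by (simpl; ring).
    apply HB. }
  rewrite !newton_qpoch_ratio by assumption.
  rewrite <- !psum_scal, <- psum_minus.
  (* [G] is the telescoping certificate: the combination of the [k]-th terms is [G (S k) - G k], and
     [G 0 = 0] through the factor [1 - q^k]. *)
  set (G := fun k => - (hpoch A B q k * nodes q x 0 k * (1 - Cpow q k)
     * (1 - B * Cpow q k) / (qpoch q q k * qpoch (B * q) q k))).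
  transitivity (G n - G O).
  2:{ unfold G. simpl. unfold Cdiv. ring. }
  rewrite <- psum_telescope. apply psum_ext. intros k _.
  unfold G. rewrite hpoch_scal.
  assert (Q0 := qpoch_q_ne_0 q k H1).
  assert (Q1 : 1 - q * Cpow q k <> 0) by (apply one_sub_ne_0, (Cpow_ne_1 q k H1)).
  assert (B1 := qpoch_ne_0 _ q k HBq).
  assert (B2 := qpoch_ne_0 _ q k HB).
  assert (B3 := one_sub_ne_0 _ (HBq k)).
  assert (B4 := one_sub_ne_0 _ (HB O)). simpl in B4. rewrite Cmult_1_r in B4.
  assert (B5 := one_sub_ne_0 _ (HB k)).
  assert (E : qpoch B q k = (1 - B) * qpoch (B * q) q k / (1 - B * Cpow q k)).
  { rewrite <- qpoch_S_l. simpl. field. exact B5. }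
  rewrite E. simpl. field. repeat split; assumption.
Qed.

(* Value at q^z of the function k |-> (A;q)_k / (B;q)_k extended off the nodes,
   with x in place of q^z. *)
Definition ratio_inf (q A B x : C) : C :=
  qpoch_inf A q * qpoch_inf (B * x) q / (qpoch_inf B q * qpoch_inf (A * x) q).

Lemma pow_arg_ne_1 (q y : C) :
  (Cmod q < 1)%R -> (Cmod y < 1)%R -> forall k, y * Cpow q k <> 1.
Proof.
  intros Hq Hy k E.
  assert (H : (Cmod (y * Cpow q k) < 1)%R).
  { rewrite Cmod_mult, Cmod_pow.
    assert (T := Cmod_ge_0 q). assert (T' := Cmod_ge_0 y).
    assert (Cmod q ^ k <= 1)%R by (rewrite <- (pow1 k); apply pow_incr; lra).
    assert (0 <= Cmod q ^ k)%R by now apply pow_le. nra. }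
  rewrite E, Cmod_1 in H. lra.
Qed.

(** This is [Cmod_hpoch_le] with [r = |x|]; as [|q^s| <= 1], one constant serves all base nodes. *)
Lemma Cmod_nodes_le (q x : C) :
  (Cmod q < 1)%R -> x <> 0 ->
  exists M, (1 <= M)%R /\
    forall s n, (Cmod (nodes q x s n) <= M * Cmod x ^ n)%R.
Proof.
  intros Hq Hx. assert (Hx' := proj1 (Cmod_gt_0 x) Hx).
  assert (Hp := Cmod_ge_0 q).
  exists (exp (1 / Cmod x / (1 - Cmod q))). split.
  { assert (0 < 1 / Cmod x / (1 - Cmod q))%R.
    { apply Rdiv_lt_0_compat; [|lra]. apply Rdiv_lt_0_compat; lra. }
    rewrite <- exp_0 at 1. left. now apply exp_increasing. }
  intros s n. rewrite nodes_hpoch.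
  eapply Rle_trans; [apply Cmod_hpoch_le with (r := Cmod x); try assumption; lra|].
  apply Rmult_le_compat_r; [apply pow_le; lra|].
  assert (H : (Cmod (Cpow q s) / Cmod x / (1 - Cmod q)
               <= 1 / Cmod x / (1 - Cmod q))%R).
  { apply Rmult_le_compat_r; [apply Rlt_le, Rinv_0_lt_compat; lra|].
    apply Rmult_le_compat_r; [apply Rlt_le, Rinv_0_lt_compat; lra|].
    rewrite Cmod_pow, <- (pow1 s). apply pow_incr. lra. }
  destruct H as [H|H]; [left; now apply exp_increasing | rewrite H; lra].
Qed.

(** Uniformity in [A] matters because the third ratio is used with [A = alpha q^(N+1)], which moves
    with [N]. *)
Lemma dd_ratio_bounded (q B : C) (r : R) :
  q <> 0 -> (Cmod q < 1)%R -> (0 < r)%R -> (forall k, B * Cpow q k <> 1) ->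
  exists K, (0 < K)%R /\ forall A, (Cmod A <= r)%R -> forall n s,
    (Cmod (dd q (fun k => (qpoch A q k / qpoch B q k)%C) n s) <= K * r ^ n)%R.
Proof.
  intros H0 H1 Hr HB.
  destruct (qpoch_inv_bounded B q H1 HB) as [KB [KB0 HKB]].
  destruct (qpoch_inv_bounded q q H1 (fun k => Cpow_ne_1 q k H1)) as [Kq [Kq0 HKq]].
  exists (exp (r / (1 - Cmod q)) * exp (Cmod B / r / (1 - Cmod q)) * (Kq * KB))%R.
  split.
  { repeat apply Rmult_lt_0_compat; try apply exp_pos; assumption. }
  intros A HA n s. rewrite dd_qpoch_ratio by assumption.
  assert (Q := qpoch_q_ne_0 q n H1). assert (QB := qpoch_ne_0 B q (s + n) HB).
  rewrite Cmod_div by now apply Cmult_neq_0.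
  rewrite !Cmod_mult. unfold Rdiv at 1. rewrite Rinv_mult.
  assert (HAs : (Cmod (qpoch A q s) <= exp (r / (1 - Cmod q)))%R).
  { eapply Rle_trans; [now apply Cmod_qpoch_le|].
    assert (HE : (Cmod A / (1 - Cmod q) <= r / (1 - Cmod q))%R).
    { apply Rmult_le_compat_r; [apply Rlt_le, Rinv_0_lt_compat; lra | exact HA]. }
    destruct HE as [HE|HE]; [left; now apply exp_increasing | rewrite HE; lra]. }
  assert (Hh := Cmod_hpoch_le A B q r n H1 Hr HA).
  replace (exp (r / (1 - Cmod q)) * exp (Cmod B / r / (1 - Cmod q)) * (Kq * KB) * r ^ n)%R
    with (exp (r / (1 - Cmod q)) * (exp (Cmod B / r / (1 - Cmod q)) * r ^ n)
          * (Kq * KB))%R by ring.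
  assert (P1 := Cmod_ge_0 (qpoch A q s)). assert (P2 := Cmod_ge_0 (hpoch A B q n)).
  assert (P3 : (0 <= / Cmod (qpoch q q n))%R)
    by now apply Rlt_le, Rinv_0_lt_compat, Cmod_gt_0.
  assert (P4 : (0 <= / Cmod (qpoch B q (s + n)))%R)
    by now apply Rlt_le, Rinv_0_lt_compat, Cmod_gt_0.
  apply Rmult_le_compat; [now apply Rmult_le_pos | now apply Rmult_le_pos | |].
  - now apply Rmult_le_compat.
  - apply Rmult_le_compat; auto.
Qed.

Lemma Clim_pow_arg (q : C) (k : nat) :
  (Cmod q < 1)%R -> Clim (fun m => Cpow (Cpow q m) (S k)) 0.
Proof.
  intros Hq. assert (T := Cmod_ge_0 q).
  apply Clim_le with (fun m => Cmod q ^ m)%R.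
  - intros m.
    replace (Cpow (Cpow q m) (S k) - 0) with (Cpow (Cpow q m) (S k)) by ring.
    rewrite Cmod_pow, Cmod_pow. simpl.
    assert (0 <= Cmod q ^ m)%R by now apply pow_le.
    assert ((Cmod q ^ m) ^ k <= 1)%R.
    { rewrite <- (pow1 k). apply pow_incr. split; [assumption|].
      rewrite <- (pow1 m). apply pow_incr. lra. }
    nra.
  - apply is_lim_seq_geom. rewrite Rabs_pos_eq; lra.
Qed.

(** The term of index [k] carries [q^(m k)], so only [k = 0] survives as [m] grows. *)
Lemma Clim_newton_ratio_shift (q A B x : C) (n : nat) :
  q <> 0 -> (Cmod q < 1)%R -> (forall k, B * Cpow q k <> 1) ->
  Clim (fun m => newton q (fun k => qpoch (A * Cpow q m) q k
                                    / qpoch (B * Cpow q m) q k) x 0 (S n)) 1.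
Proof.
  intros H0 H1 HB.
  (* Here [1 / (B q^m; q)_k] is written as [(B; q)_m / (B; q)_(m+k)], a quotient of sequences with
     the same nonzero limit. *)
  set (t := fun m k => Cpow (Cpow q m) k * (hpoch A B q k * nodes q x 0 k / qpoch q q k)
              * (qpoch B q m * / qpoch B q (m + k))).
  apply Clim_ext with (fun m => psum (t m) (S n)).
  { intros m. rewrite newton_qpoch_ratio by (try assumption; now apply shifted_ne_1).
    apply psum_ext. intros k _. unfold t.
    rewrite hpoch_scal, qpoch_add. field.
    repeat split; [|now apply qpoch_q_ne_0|now apply qpoch_ne_0].
    now apply qpoch_ne_0, shifted_ne_1. }
  replace (RtoC 1) with (psum (fun k => match k with O => 1 | S _ => 0 end) (S n)).
  2:{ rewrite psum_shift. clear. induction n as [|n IH]; simpl in *; [ring|].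
      rewrite Cplus_assoc, IH. ring. }
  apply Clim_psum. intros k _. unfold t. destruct k as [|k].
  - apply Clim_ext with (fun _ => 1); [|apply Clim_const].
    intros m. rewrite Nat.add_0_r. simpl. field. now apply qpoch_ne_0.
  - replace (RtoC 0) with (0 * (hpoch A B q (S k) * nodes q x 0 (S k) / qpoch q q (S k))
        * (qpoch_inf B q * / qpoch_inf B q)) by ring.
    apply Clim_mult; [apply Clim_mult; [now apply Clim_pow_arg | apply Clim_const]|].
    apply Clim_mult; [now apply Clim_qpoch|].
    apply Clim_ext with (fun m => / qpoch B q (S k + m)).
    + intros m. now rewrite Nat.add_comm.
    + apply (Clim_shift (fun m => / qpoch B q m)). now apply Clim_qpoch_inv.
Qed.

(* Iterating the contiguous relation (A, B) -> (A q, B q) multiplies the value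
   by the factor whose infinite product is [ratio_inf], and the shifted
   interpolants tend to 1: this is the q-Gauss sum. *)
Lemma q_gauss (q A B x : C) (r : R) :
  q <> 0 -> (Cmod q < 1)%R -> (forall k, B * Cpow q k <> 1) ->
  x <> 0 -> (0 < r)%R -> (Cmod A <= r)%R -> (r * Cmod x < 1)%R ->
  Clim (newton q (fun k => qpoch A q k / qpoch B q k) x 0) (ratio_inf q A B x).
Proof.
  intros H0 H1 HB Hx Hr HA Hrx.
  assert (Hp := Cmod_ge_0 q). assert (Hxp := proj1 (Cmod_gt_0 x) Hx).
  assert (HAx : forall k, A * x * Cpow q k <> 1).
  { apply pow_arg_ne_1; [assumption|]. rewrite Cmod_mult.
    apply Rle_lt_trans with (2 := Hrx). apply Rmult_le_compat_r; lra. }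
  set (T := fun n m => newton q (fun k => qpoch (A * Cpow q m) q k
                                    / qpoch (B * Cpow q m) q k) x 0 n).
  (* [P m] accumulates the factors of the contiguous relation, so [P m * T n m] is constant in [m]
     up to the truncation remainders. For [n > 0] it leads from the Newton sum at [m = 0] to
     [ratio_inf] in the limit. *)
  set (P := fun m => qpoch A q m * qpoch (B * x) q m
                     * (/ qpoch B q m * / qpoch (A * x) q m)).
  assert (HP : Clim P (ratio_inf q A B x)).
  { unfold P, ratio_inf, Cdiv.
    replace (/ (qpoch_inf B q * qpoch_inf (A * x) q))
      with (/ qpoch_inf B q * / qpoch_inf (A * x) q)
      by (field; split; now apply qpoch_inf_ne_0).
    repeat apply Clim_mult; try now apply Clim_qpoch.
    all: now apply Clim_qpoch_inv. }
  destruct (Cmod_nodes_le q x H1 Hx) as [M [HM HMn]].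
  destruct (qpoch_inv_bounded B q H1 HB) as [KB [KB0 HKB]].
  destruct (qpoch_inv_bounded (A * x) q H1 HAx) as [KA [KA0 HKA]].
  destruct (qpoch_inv_bounded q q H1 (fun k => Cpow_ne_1 q k H1)) as [Kq [Kq0 HKq]].
  set (E := fun y => exp (Cmod y / (1 - Cmod q))).
  set (h := exp (Cmod B / r / (1 - Cmod q))).
  set (K0 := (E A * E (B * x)%C * (KB * KA) * (h * M * (2 * (1 + Cmod B))
               * (Kq * (KB * E B))))%R).
  (* The remainder decays in both indices: [(r |x|)^(n+1)] comes from [hpoch] and [nodes], and
     [|q|^m] from the scaling factor [q^(m (n+1))]. The latter decays in [m] only with at least one
     term, hence [S n]. *)
  assert (Hstep : forall n m,
    (Cmod (P (S m) * T (S n) (S m) - P m * T (S n) m)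
     <= K0 * (r * Cmod x) ^ S n * Cmod q ^ m)%R).
  { intros n m.
    assert (HBm := shifted_ne_1 q B m HB).
    assert (C := newton_ratio_contiguous q (A * Cpow q m) (B * Cpow q m) x (S n)
                   H0 H1 HBm).
    fold (T (S n) m) in C.
    replace (newton q (fun k => qpoch (A * Cpow q m * q) q k
                                / qpoch (B * Cpow q m * q) q k) x 0 (S n))
      with (T (S n) (S m)) in C.
    2:{ unfold T. apply newton_ext. intros k. simpl.
        now rewrite !(Cmult_comm q), !Cmult_assoc. }
    rewrite hpoch_scal in C.
    set (u := Cpow (Cpow q m) (S n)) in *.
    set (W := hpoch A B q (S n) * nodes q x 0 (S n) * ((1 - Cpow q (S n))
              * (1 - B * Cpow q (m + S n)))
              * (/ qpoch q q (S n) * (/ qpoch B q (S m + S n) * qpoch B q (S m)))).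
    assert (N1 := qpoch_ne_0 _ q m HB). assert (N2 := qpoch_ne_0 _ q (S m) HB).
    assert (N3 := qpoch_ne_0 _ q (S m) HAx). assert (N4 := qpoch_ne_0 _ q m HAx).
    assert (N5 := one_sub_ne_0 _ (HB m)). assert (N6 := one_sub_ne_0 _ (HAx m)).
    assert (N7 := qpoch_q_ne_0 q (S n) H1).
    assert (N8 := qpoch_ne_0 _ q (S n) (shifted_ne_1 q B (S m) HB)).
    assert (EQ : P (S m) * T (S n) (S m) - P m * T (S n) m
      = qpoch A q m * qpoch (B * x) q m
        * (/ qpoch B q (S m) * / qpoch (A * x) q (S m)) * (u * W)).
    { transitivity (qpoch A q m * qpoch (B * x) q m
        * (/ qpoch B q (S m) * / qpoch (A * x) q (S m)) *
        - ((1 - B * Cpow q m) * (1 - A * Cpow q m * x) * T (S n) m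
           - (1 - A * Cpow q m) * (1 - B * Cpow q m * x) * T (S n) (S m))).
      - unfold P. simpl qpoch. field. repeat split; assumption.
      - rewrite C. f_equal. unfold W. rewrite (qpoch_add B q (S m)).
        replace (B * Cpow q m * q) with (B * Cpow q (S m)) by (simpl; ring).
        rewrite (Cpow_add_r q m (S n)).
        field. repeat split; assumption. }
    rewrite EQ. rewrite !Cmod_mult.
    assert (Hu : (Cmod u <= Cmod q ^ m)%R).
    { unfold u. rewrite !Cmod_pow. simpl.
      assert (0 <= Cmod q ^ m)%R by now apply pow_le.
      assert ((Cmod q ^ m) ^ n <= 1)%R.
      { rewrite <- (pow1 n). apply pow_incr. split; [assumption|].
        rewrite <- (pow1 m). apply pow_incr. lra. }
      nra. }
    assert (Hq1 : forall k, (Cmod q ^ k <= 1)%R).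
    { intros k. rewrite <- (pow1 k). apply pow_incr. lra. }
    assert (HW : (Cmod W <= h * r ^ S n * (M * Cmod x ^ S n)
                  * (2 * (1 + Cmod B)) * (Kq * (KB * E B)))%R).
    { unfold W. rewrite !Cmod_mult, !Cmod_inv by
        (try assumption; now apply qpoch_ne_0).
      repeat apply Rmult_le_compat; try apply Cmod_ge_0;
        repeat apply Rmult_le_pos; try apply Cmod_ge_0;
        try (apply Rlt_le, Rinv_0_lt_compat, Cmod_gt_0; now apply qpoch_ne_0);
        try (apply Rlt_le, Rinv_0_lt_compat, Cmod_gt_0; assumption).
      - now apply Cmod_hpoch_le.
      - apply HMn.
      - unfold Cminus. eapply Rle_trans; [apply Cmod_triangle|].
        rewrite Cmod_opp, Cmod_1, Cmod_pow. specialize (Hq1 (S n)). lra.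
      - unfold Cminus. eapply Rle_trans; [apply Cmod_triangle|].
        rewrite Cmod_opp, Cmod_1, Cmod_mult, Cmod_pow.
        specialize (Hq1 (m + S n)%nat).
        assert (T1 := Cmod_ge_0 B). nra.
      - apply HKq.
      - apply HKB.
      - now apply Cmod_qpoch_le. }
    rewrite !Cmod_inv by assumption.
    apply Rle_trans with ((E A * E (B * x)%C * (KB * KA)) * (Cmod q ^ m *
      (h * r ^ S n * (M * Cmod x ^ S n)
                  * (2 * (1 + Cmod B)) * (Kq * (KB * E B)))))%R.
    - repeat apply Rmult_le_compat; try apply Cmod_ge_0;
        repeat apply Rmult_le_pos; try apply Cmod_ge_0;
        try (apply Rlt_le, Rinv_0_lt_compat, Cmod_gt_0; assumption);
        try (now apply Cmod_qpoch_le); auto.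
    - unfold K0. rewrite Rpow_mult_distr. right. ring. }
  apply (Clim_shift _ _ 1).
  apply Clim_le with (fun n => K0 / (1 - Cmod q) * (r * Cmod x) ^ S n)%R.
  - intros n.
    assert (HL : Clim (fun m => P m * T (S n) m) (ratio_inf q A B x * 1)).
    { apply Clim_mult; [exact HP|]. now apply Clim_newton_ratio_shift. }
    (* Summing the increments over [m] bounds the distance from [m = 0] to the limit, and the factor
       [(r |x|)^(n+1)] is retained. *)
    assert (Z := Clim_geometric_rate _ _ _ (Cmod q) 0 (conj Hp H1) (Hstep n) HL).
    cbv beta in Z. rewrite pow_O in Z.
    replace (ratio_inf q A B x * 1 - P O * T (S n) O)
      with (- (newton q (fun k => qpoch A q k / qpoch B q k) x 0 (1 + n)
               - ratio_inf q A B x)) in Z.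
    2:{ unfold P, T. simpl Cpow. rewrite !Cmult_1_r. change (1 + n)%nat with (S n).
        change (qpoch A q 0) with (RtoC 1). change (qpoch (B * x) q 0) with (RtoC 1).
        change (qpoch B q 0) with (RtoC 1). change (qpoch (A * x) q 0) with (RtoC 1).
        field. }
    rewrite Cmod_opp in Z. eapply Rle_trans; [exact Z|]. right. field. lra.
  - replace 0%R with (K0 / (1 - Cmod q) * 0)%R by ring.
    apply is_lim_seq_mult'; [apply is_lim_seq_const|].
    apply (is_lim_seq_incr_1 (fun n => (r * Cmod x) ^ n)%R).
    apply is_lim_seq_geom. rewrite Rabs_pos_eq; [exact Hrx|].
    apply Rmult_le_pos; lra.
Qed.

(** * Interpolation errors of products *)

(** The bounds are uniform in the base node because [newton_mul] uses polynomials of [g] based at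
    [q^(s+k)]. The exponent [d] counts the multiplications made, each of which costs one power of
    [n + 1]. *)
Definition newton_bound (q x : C) (r : R) (d : nat) (K : R) (f : nat -> C) (fx : C)
  : Prop :=
  (forall n s, (Cmod (dd q f n s) <= K * INR (S n) ^ d * r ^ n)%R) /\
  (forall n s, (Cmod (fx - newton q f x s n) <= K * INR (S n) ^ d * (r * Cmod x) ^ n)%R).

(** By [newton_S_l], moving the base node changes the polynomial by one term of order [(r |x|)^n],
    which vanishes in the limit. *)
Lemma Clim_newton_shift (q : C) (f : nat -> C) (x fx : C) (r K : R) (s : nat) :
  q <> 0 -> (Cmod q < 1)%R -> x <> 0 -> (0 < r)%R -> (r * Cmod x < 1)%R ->
  (forall n s, (Cmod (dd q f n s) <= K * r ^ n)%R) ->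
  Clim (newton q f x 0) fx -> Clim (newton q f x s) fx.
Proof.
  intros H0 H1 Hx Hr Hrx HK H.
  assert (Hxp := proj1 (Cmod_gt_0 x) Hx).
  destruct (Cmod_nodes_le q x H1 Hx) as [M [HM HMn]].
  induction s as [|s IH]; [exact H|].
  replace fx with (fx + (- (1)) * 0) by ring.
  apply Clim_ext with (fun n => newton q f x s (1 + n)
                                + - (1) * (dd q f n s * nodes q x (S s) n)).
  { intros n. simpl Nat.add. rewrite newton_S_l by assumption. ring. }
  apply Clim_plus; [now apply (Clim_shift (newton q f x s))|].
  apply Clim_mult; [apply Clim_const|].
  apply Clim_le with (fun n => K * M * (r * Cmod x) ^ n)%R.
  - intros n.
    replace (dd q f n s * nodes q x (S s) n - 0)
      with (dd q f n s * nodes q x (S s) n) by ring.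
    rewrite Cmod_mult.
    replace (K * M * (r * Cmod x) ^ n)%R with (K * r ^ n * (M * Cmod x ^ n))%R
      by (rewrite Rpow_mult_distr; ring).
    apply Rmult_le_compat; try apply Cmod_ge_0; [apply HK | apply HMn].
  - replace 0%R with (K * M * 0)%R by ring.
    apply is_lim_seq_mult'; [apply is_lim_seq_const|].
    apply is_lim_seq_geom. rewrite Rabs_pos_eq; [exact Hrx|].
    apply Rmult_le_pos; lra.
Qed.

(** The error is the tail of the Newton series, which converges by [q_gauss] and has geometrically
    bounded terms. *)
Lemma newton_bound_ratio (q B x : C) (r : R) :
  q <> 0 -> (Cmod q < 1)%R -> (forall k, B * Cpow q k <> 1) ->
  x <> 0 -> (0 < r)%R -> (r * Cmod x < 1)%R ->
  exists K, (0 < K)%R /\ forall A, (Cmod A <= r)%R ->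
    newton_bound q x r 0 K (fun k => qpoch A q k / qpoch B q k) (ratio_inf q A B x).
Proof.
  intros H0 H1 HB Hx Hr Hrx.
  assert (Hxp := proj1 (Cmod_gt_0 x) Hx).
  destruct (dd_ratio_bounded q B r H0 H1 Hr HB) as [K [HK HKd]].
  destruct (Cmod_nodes_le q x H1 Hx) as [M [HM HMn]].
  set (K1 := (K * M / (1 - r * Cmod x))%R).
  assert (Hrx0 : (0 <= r * Cmod x)%R) by (apply Rmult_le_pos; lra).
  assert (HK1 : (0 < K1)%R).
  { apply Rdiv_lt_0_compat; [|lra]. apply Rmult_lt_0_compat; lra. }
  exists (K + K1)%R. split; [lra|]. intros A HA. split; intros n s; simpl pow at 1.
  - eapply Rle_trans; [now apply HKd|].
    assert (0 <= r ^ n)%R by (apply pow_le; lra). nra.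
  - assert (Hs := Clim_newton_shift q _ x (ratio_inf q A B x) r K s H0 H1 Hx Hr Hrx
                    (HKd A HA) (q_gauss q A B x r H0 H1 HB Hx Hr HA Hrx)).
    assert (Z : (Cmod (ratio_inf q A B x
      - newton q (fun k => (qpoch A q k / qpoch B q k)%C) x s n)
      <= K * M / (1 - r * Cmod x) * (r * Cmod x) ^ n)%R).
    { apply Clim_geometric_rate; [split; assumption| |exact Hs].
      intros m. unfold newton. rewrite psum_S.
      match goal with |- (Cmod (?a + ?b - ?a)%C <= _)%R =>
        replace (a + b - a) with b by ring end.
      rewrite Cmod_mult.
      replace (K * M * (r * Cmod x) ^ m)%R with (K * r ^ m * (M * Cmod x ^ m))%R
        by (rewrite Rpow_mult_distr; ring).
      apply Rmult_le_compat; try apply Cmod_ge_0; [now apply HKd | apply HMn]. }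
    eapply Rle_trans; [exact Z|]. fold K1.
    assert (0 <= (r * Cmod x) ^ n)%R by now apply pow_le. nra.
Qed.

(** In [dd_mul] and [newton_mul] the powers of [r] and of [r |x|] combine to the same exponent [n]
    in every term; the number of terms gives the extra power of [n + 1]. *)
Lemma newton_bound_mul (q x : C) (r : R) (d e : nat) :
  q <> 0 -> (Cmod q < 1)%R -> x <> 0 -> (0 < r)%R ->
  exists M, (0 < M)%R /\ forall f fx g gx K L, (0 < K)%R -> (0 < L)%R ->
    newton_bound q x r d K f fx -> newton_bound q x r e L g gx ->
    newton_bound q x r (S (d + e)) (K * L * M) (fun k => f k * g k) (fx * gx).
Proof.
  intros H0 H1 Hx Hr. assert (Hxp := proj1 (Cmod_gt_0 x) Hx).
  destruct (Cmod_nodes_le q x H1 Hx) as [M [HM HMn]].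
  exists M. split; [lra|].
  intros f fx g gx K L HK HL [Hfd Hfr] [Hgd Hgr].
  assert (HINR : forall k n m, (k <= n)%nat -> (0 <= INR (S k) ^ m <= INR (S n) ^ m)%R).
  { intros k n m Hkn. assert (T := pos_INR (S k)). split; [now apply pow_le|].
    apply pow_incr. split; [exact T | apply le_INR; lia]. }
  split; intros n s.
  - rewrite dd_mul by assumption.
    eapply Rle_trans.
    { apply Cmod_psum_le with
        (K := (K * L * M * INR (S n) ^ (d + e) * r ^ n)%R).
      intros k Hk. rewrite Cmod_mult.
      apply Rle_trans with ((K * INR (S n) ^ d * r ^ k)
                            * (L * INR (S n) ^ e * r ^ (n - k)))%R.
      - assert (Z1 := HINR k n d ltac:(lia)).
        assert (Z2 := HINR (n - k)%nat n e ltac:(lia)).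
        apply Rmult_le_compat; try apply Cmod_ge_0.
        + eapply Rle_trans; [apply Hfd|].
          apply Rmult_le_compat_r; [apply pow_le; lra|].
          apply Rmult_le_compat_l; lra.
        + eapply Rle_trans; [apply Hgd|].
          apply Rmult_le_compat_r; [apply pow_le; lra|].
          apply Rmult_le_compat_l; lra.
      - rewrite pow_add.
        replace (r ^ n)%R with (r ^ k * r ^ (n - k))%R
          by (rewrite <- pow_add; f_equal; lia).
        replace (K * INR (S n) ^ d * r ^ k * (L * INR (S n) ^ e * r ^ (n - k)))%R
          with (K * L * INR (S n) ^ d * INR (S n) ^ e * (r ^ k * r ^ (n - k)) * 1)%R
          by ring.
        replace (K * L * M * (INR (S n) ^ d * INR (S n) ^ e) * (r ^ k * r ^ (n - k)))%R
          with (K * L * INR (S n) ^ d * INR (S n) ^ e * (r ^ k * r ^ (n - k)) * M)%R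
          by ring.
        apply Rmult_le_compat_l; [|exact HM].
        assert (P := fun m => pow_le (INR (S n)) m (pos_INR _)).
        assert (P' := fun m => pow_le r m (Rlt_le _ _ Hr)).
        repeat apply Rmult_le_pos; auto; lra. }
    right. rewrite <- tech_pow_Rmult. ring.
  - rewrite (newton_mul q f g x gx) by assumption.
    set (rho := (r * Cmod x)%R).
    assert (Hrho : (0 <= rho)%R) by (apply Rmult_le_pos; lra).
    assert (P := fun m => pow_le (INR (S n)) m (pos_INR _)).
    assert (P' := fun m => pow_le rho m Hrho).
    (* The empty Newton polynomial is [0], so the error bound at [n = 0] bounds [gx] itself. *)
    assert (Hgx : (Cmod gx <= L)%R).
    { assert (Z := Hgr O O). unfold newton in Z. simpl in Z.
      replace (gx - 0) with gx in Z by ring.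
      rewrite pow1, !Rmult_1_r in Z. exact Z. }
    match goal with |- context [psum ?u n] =>
      replace (fx * gx - (newton q f x s n * gx - psum u n))
        with ((fx - newton q f x s n) * gx + psum u n) by ring;
      assert (HS : (Cmod (psum u n)
                 <= INR n * (K * L * M * INR (S n) ^ (d + e) * rho ^ n))%R)
    end.
    { apply Cmod_psum_le. intros k Hk. rewrite !Cmod_mult.
      apply Rle_trans with ((K * INR (S n) ^ d * r ^ k) * (M * Cmod x ^ k)
                            * (L * INR (S n) ^ e * rho ^ (n - k)))%R.
      - assert (Z1 := HINR k n d ltac:(lia)).
        assert (Z2 := HINR (n - k)%nat n e ltac:(lia)).
        repeat apply Rmult_le_compat; try apply Cmod_ge_0;
          try (apply Rmult_le_pos; apply Cmod_ge_0).
        + eapply Rle_trans; [apply Hfd|].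
          apply Rmult_le_compat_r; [apply pow_le; lra|].
          apply Rmult_le_compat_l; lra.
        + apply HMn.
        + eapply Rle_trans; [apply Hgr|].
          apply Rmult_le_compat_r; [apply P'|].
          apply Rmult_le_compat_l; lra.
      - right. rewrite pow_add.
        replace (rho ^ n)%R with (rho ^ k * rho ^ (n - k))%R
          by (rewrite <- pow_add; f_equal; lia).
        unfold rho at 2. rewrite Rpow_mult_distr. ring. }
    assert (HF : (Cmod ((fx - newton q f x s n) * gx)
                  <= K * L * M * INR (S n) ^ (d + e) * rho ^ n)%R).
    { rewrite Cmod_mult.
      apply Rle_trans with ((K * INR (S n) ^ d * rho ^ n) * L)%R.
      - apply Rmult_le_compat; try apply Cmod_ge_0; [apply Hfr | exact Hgx].
      - assert (H1S : (1 <= INR (S n) ^ e)%R).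
        { apply pow_R1_Rle. rewrite S_INR. assert (T := pos_INR n). lra. }
        rewrite pow_add.
        replace (K * INR (S n) ^ d * rho ^ n * L)%R
          with (K * L * INR (S n) ^ d * rho ^ n * (1 * 1))%R by ring.
        replace (K * L * M * (INR (S n) ^ d * INR (S n) ^ e) * rho ^ n)%R
          with (K * L * INR (S n) ^ d * rho ^ n * (M * INR (S n) ^ e))%R by ring.
        apply Rmult_le_compat_l.
        + repeat apply Rmult_le_pos; auto; lra.
        + apply Rmult_le_compat; lra. }
    eapply Rle_trans; [apply Cmod_triangle|].
    (* The extra factor [n + 1] is split as [1 + n]: one share for the error of [f], and [n] for the
       sum. *)
    replace (K * L * M * INR (S n) ^ S (d + e) * rho ^ n)%R
      with (K * L * M * INR (S n) ^ (d + e) * rho ^ n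
            + INR n * (K * L * M * INR (S n) ^ (d + e) * rho ^ n))%R.
    2:{ rewrite <- tech_pow_Rmult. set (w := (INR (S n) ^ (d + e))%R).
        rewrite S_INR. ring. }
    lra.
Qed.

(** With [t] the fourth root of [p], Bernoulli's inequality bounds [(n + 1) t^n]. The square of this
    absorbs the polynomial factor and leaves [(t^2)^n]. *)
Lemma is_lim_seq_poly_geom (p : R) :
  (0 < p < 1)%R -> is_lim_seq (fun n => INR (S n) ^ 2 * p ^ n)%R 0%R.
Proof.
  intros Hp. set (t := sqrt (sqrt p)).
  assert (Hs : (0 < sqrt p)%R) by (apply sqrt_lt_R0; lra).
  assert (Ht : (0 < t)%R) by now apply sqrt_lt_R0.
  assert (Hs1 : (sqrt p < 1)%R) by (rewrite <- sqrt_1; apply sqrt_lt_1_alt; lra).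
  assert (Ht1 : (t < 1)%R) by (rewrite <- sqrt_1; apply sqrt_lt_1_alt; lra).
  assert (Et : (p = t * t * (t * t))%R).
  { unfold t. rewrite !sqrt_sqrt; lra. }
  set (h := (/ t - 1)%R).
  assert (Hh : (0 < h)%R).
  { unfold h. assert (T := Rinv_lt_contravar t 1). rewrite Rinv_1 in T.
    assert (1 < / t)%R by (apply T; lra). lra. }
  (* This choice gives [c (n + 1) <= 1 + n h <= (1 + h)^n = t^(-n)]. *)
  set (c := Rmin 1 h).
  assert (Hc : (0 < c)%R) by (apply Rmin_pos; lra).
  assert (HB : forall n, (INR (S n) * t ^ n <= / c)%R).
  { intros n. assert (T := poly n h Hh).
    replace (1 + h)%R with (/ t)%R in T by (unfold h; ring).
    assert (Hc1 : (c <= 1)%R) by apply Rmin_l.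
    assert (Hc2 : (c <= h)%R) by apply Rmin_r.
    assert (Hn := pos_INR n).
    assert (Htn : (0 < t ^ n)%R) by now apply pow_lt.
    rewrite pow_inv in T.
    apply (Rmult_le_reg_l c); [exact Hc|]. rewrite Rinv_r by lra.
    assert (T2 : (c * INR (S n) <= / t ^ n)%R) by (rewrite S_INR; nra).
    apply (Rmult_le_compat_r (t ^ n)) in T2; [|lra].
    rewrite Rinv_l in T2 by lra. lra. }
  apply is_lim_seq_le_le with (fun _ => 0%R) (fun n => / c * / c * (t * t) ^ n)%R.
  - intros n. specialize (HB n). assert (Hn := pos_INR (S n)).
    assert (Htn : (0 < t ^ n)%R) by now apply pow_lt.
    rewrite Et, !Rpow_mult_distr.
    replace (INR (S n) ^ 2 * (t ^ n * t ^ n * (t ^ n * t ^ n)))%R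
      with ((INR (S n) * t ^ n) * (INR (S n) * t ^ n) * (t ^ n * t ^ n))%R by ring.
    assert (H0 : (0 <= INR (S n) * t ^ n)%R) by (apply Rmult_le_pos; lra).
    split.
    + apply Rmult_le_pos; apply Rmult_le_pos; lra.
    + apply Rmult_le_compat_r; [apply Rmult_le_pos; lra|].
      now apply Rmult_le_compat.
  - apply is_lim_seq_const.
  - replace 0%R with (/ c * / c * 0)%R by ring.
    apply is_lim_seq_mult'; [apply is_lim_seq_const|].
    apply is_lim_seq_geom. rewrite Rabs_pos_eq by nra. nra.
Qed.

(** * The terminating 4phi3 as a divided difference *)

Lemma Csum_unique (u : nat -> C) (l : C) : is_series u l -> Csum u = l.
Proof.
  intros H. unfold Csum.
  assert (H' := epsilon_spec (inhabits (RtoC 0%R)) (fun l : C => is_series u l)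
                  (ex_intro _ l H)).
  apply is_series_Clim in H. apply is_series_Clim in H'.
  exact (Clim_unique _ _ _ H' H).
Qed.

Lemma qpoch_inv_pow_vanish (q : C) (n k : nat) :
  q <> 0 -> qpoch (/ Cpow q n) q (S n + k) = 0.
Proof.
  intros H0. rewrite qpoch_add.
  change (qpoch (/ Cpow q n) q (S n))
    with (qpoch (/ Cpow q n) q n * (1 - / Cpow q n * Cpow q n)).
  rewrite Cinv_l by now apply Cpow_nz. ring.
Qed.

(** The parameter [q^(-n)] makes all terms beyond index [n] vanish, and the others form the Lagrange
    sum of [dd_explicit] at [s = 0]. *)
Lemma phi43_dd (q a2 a3 a4 b1 b2 b3 : C) (n : nat) :
  q <> 0 -> (Cmod q < 1)%R ->
  (forall k, b1 * Cpow q k <> 1) -> (forall k, b2 * Cpow q k <> 1) ->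
  (forall k, b3 * Cpow q k <> 1) ->
  phi43 (/ Cpow q n) a2 a3 a4 b1 b2 b3 q q
  = qpoch q q n * dd q (fun k => qpoch a2 q k * (qpoch a3 q k * qpoch a4 q k
                          / (qpoch b1 q k * qpoch b2 q k * qpoch b3 q k))) n 0.
Proof.
  intros H0 H1 Hb1 Hb2 Hb3. unfold phi43. apply Csum_unique.
  apply is_series_Clim.
  match goal with |- Clim (psum ?u) _ => set (t := u) end.
  assert (Ht : qpoch q q n * dd q (fun k => qpoch a2 q k * (qpoch a3 q k * qpoch a4 q k
                 / (qpoch b1 q k * qpoch b2 q k * qpoch b3 q k))) n 0 = psum t (S n)).
  { transitivity (Cpow q (0 * n) * qpoch q q n * dd q (fun k => qpoch a2 q k *
      (qpoch a3 q k * qpoch a4 q k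
        / (qpoch b1 q k * qpoch b2 q k * qpoch b3 q k))) n 0); [simpl; ring|].
    rewrite dd_explicit by assumption. apply psum_ext. intros k _. unfold t. simpl.
    field. repeat split; try (now apply qpoch_ne_0); now apply qpoch_q_ne_0. }
  rewrite Ht. apply (Clim_shift _ _ (S n)).
  apply Clim_ext with (fun _ => psum t (S n)); [|apply Clim_const].
  intros k. induction k as [|k IH]; [now rewrite Nat.add_0_r|].
  rewrite Nat.add_succ_r, (psum_S t (S n + k)), <- IH. unfold t at 3.
  rewrite qpoch_inv_pow_vanish by assumption. unfold Cdiv. ring.
Qed.

Lemma nodes_qpoch (q c : C) (n : nat) :
  q <> 0 -> c <> 0 -> nodes q (c / q) 0 n = qpoch (q / c) q n * Cpow (c / q) n.
Proof.
  intros Hq Hc. induction n as [|n IH]; simpl; [ring|].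
  rewrite IH. field. now split.
Qed.

(** * Convergence of the partial sums to the infinite product *)

Theorem theorem4p1 (q alpha a b c beta gamma : C) :
  q <> 0 -> (Cmod q < 1)%R ->
  (Rmax (Cmod (alpha * beta * a * b * c / (q * q)))
        (Cmod (alpha * gamma * a * b * c / (q * q))) < 1)%R ->
  (* non-degeneracy: all denominators are nonzero *)
  c <> 0 -> alpha <> 1 ->
  (forall k : nat,
      alpha * a * Cpow q k <> 1 /\
      alpha * b * Cpow q k <> 1 /\
      alpha * c * Cpow q k <> 1 /\
      alpha * beta * a * b * c / (q * q) * Cpow q k <> 1 /\
      alpha * gamma * a * b * c / (q * q) * Cpow q k <> 1 /\
      alpha * beta * gamma * a * b / q * Cpow q k <> 1) ->
  is_series
    (fun n : nat =>
       (1 - alpha * Cpow q (2 * n)) * qpoch alpha q n * qpoch (q / c) q n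
         * Cpow (c / q) n
       / ((1 - alpha) * qpoch q q n * qpoch (alpha * c) q n)
       * phi43 (/ Cpow q n) (alpha * Cpow q n)
               (alpha * beta * a * b / q) (alpha * gamma * a * b / q)
               (alpha * a) (alpha * b) (alpha * beta * gamma * a * b / q)
               q q)
    ((qpoch_inf (q * alpha) q * qpoch_inf (alpha * a * c / q) q
      * qpoch_inf (alpha * b * c / q) q * qpoch_inf (alpha * beta * a * b / q) q
      * qpoch_inf (alpha * gamma * a * b / q) q
      * qpoch_inf (alpha * beta * gamma * a * b * c / (q * q)) q)
     / (qpoch_inf (alpha * a) q * qpoch_inf (alpha * b) q * qpoch_inf (alpha * c) q
        * qpoch_inf (alpha * beta * a * b * c / (q * q)) q
        * qpoch_inf (alpha * gamma * a * b * c / (q * q)) q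
        * qpoch_inf (alpha * beta * gamma * a * b / q) q)).
Proof.
  intros H0 H1 Hmax Hc Ha Hnd.
  set (x := c / q).
  set (A := alpha * beta * a * b / q). set (B := alpha * gamma * a * b / q).
  set (C1 := alpha * a). set (D := alpha * b).
  set (E := alpha * beta * gamma * a * b / q).
  replace (alpha * beta * a * b * c / (q * q)) with (A * x) in *
    by (unfold A, x; field; exact H0).
  replace (alpha * gamma * a * b * c / (q * q)) with (B * x) in *
    by (unfold B, x; field; exact H0).
  replace (alpha * beta * gamma * a * b * c / (q * q)) with (E * x)
    by (unfold E, x; field; exact H0).
  replace (C1 * c / q) with (C1 * x) by (unfold x; field; exact H0).
  replace (D * c / q) with (D * x) by (unfold x; field; exact H0).
  replace (q * alpha) with (alpha * q) by ring.
  replace (alpha * c) with (alpha * q * x) in * by (unfold x; field; exact H0).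
  assert (HC : forall k, C1 * Cpow q k <> 1) by (intros k; apply (Hnd k)).
  assert (HD : forall k, D * Cpow q k <> 1) by (intros k; apply (Hnd k)).
  assert (Hac : forall k, alpha * q * x * Cpow q k <> 1) by (intros k; apply (Hnd k)).
  assert (HAx : forall k, A * x * Cpow q k <> 1) by (intros k; apply (Hnd k)).
  assert (HBx : forall k, B * x * Cpow q k <> 1) by (intros k; apply (Hnd k)).
  assert (HE : forall k, E * Cpow q k <> 1) by (intros k; apply (Hnd k)).
  assert (Hx : x <> 0).
  { intros Ex. apply Hc. replace c with (x * q) by (unfold x; field; exact H0).
    rewrite Ex. ring. }
  assert (Hxp := proj1 (Cmod_gt_0 x) Hx). assert (Hp := Cmod_ge_0 q).
  (* The entry [1 / (2 |x|)] in the maximum keeps [r] positive even when [A = B = 0], and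
     [r |x| < 1] still holds. *)
  assert (Hmod : exists r, (0 < r)%R /\ (Cmod A <= r)%R /\ (Cmod B <= r)%R
                   /\ (r * Cmod x < 1)%R).
  { rewrite !Cmod_mult in Hmax.
    exists (Rmax (Rmax (Cmod A) (Cmod B)) (/ (2 * Cmod x))).
    assert (Hi : (0 < / (2 * Cmod x))%R) by (apply Rinv_0_lt_compat; lra).
    repeat split.
    - eapply Rlt_le_trans; [exact Hi | apply Rmax_r].
    - eapply Rle_trans; [apply Rmax_l | apply Rmax_l].
    - eapply Rle_trans; [apply Rmax_r | apply Rmax_l].
    - assert (Hh : (/ (2 * Cmod x) * Cmod x < 1)%R).
      { replace (/ (2 * Cmod x) * Cmod x)%R with (1 / 2)%R by (field; lra). lra. }
      assert (HA1 := Rle_lt_trans _ _ _ (Rmax_l _ _) Hmax).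
      assert (HB1 := Rle_lt_trans _ _ _ (Rmax_r _ _) Hmax).
      unfold Rmax at 1. destruct (Rle_dec _ _); [assumption|].
      unfold Rmax. now destruct (Rle_dec _ _). }
  destruct Hmod as [r [Hr [HAr [HBr Hrx]]]].
  destruct (newton_bound_ratio q C1 x r) as [K1 [HK1 HB1]]; try assumption.
  destruct (newton_bound_ratio q D x r) as [K2 [HK2 HB2]]; try assumption.
  destruct (newton_bound_ratio q E x r) as [K3 [HK3 HB3]]; try assumption.
  specialize (HB1 A HAr). specialize (HB2 B HBr).
  (* Two multiplications join the three ratios, so the exponent of [n + 1] goes from [0] to [1] to
     [2]. *)
  destruct (newton_bound_mul q x r 0 0) as [M1 [HM1 HP1]]; try assumption.
  destruct (newton_bound_mul q x r 1 0) as [M2 [HM2 HP2]]; try assumption.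
  specialize (HP1 _ _ _ _ _ _ HK1 HK2 HB1 HB2).
  assert (HK12 : (0 < K1 * K2 * M1)%R)
    by (repeat apply Rmult_lt_0_compat; assumption).
  set (K := (K1 * K2 * M1 * K3 * M2)%R).
  assert (HK : (0 < K)%R) by (unfold K; repeat apply Rmult_lt_0_compat; assumption).
  destruct (qpoch_inv_bounded (alpha * q * x) q H1 Hac) as [Kc [HKc HKc']].
  (* The parameter [alpha q^(N+1)] of the third ratio has to satisfy the bound by [r], which is
     ensured from [N0] on. *)
  assert (HN : exists N0, forall m, (Cmod (alpha * Cpow q (S (N0 + m))) <= r)%R).
  { assert (HL : is_lim_seq (fun n => Cmod alpha * Cmod q ^ n)%R 0%R).
    { replace 0%R with (Cmod alpha * 0)%R by ring.
      apply is_lim_seq_mult'; [apply is_lim_seq_const|].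
      apply is_lim_seq_geom. rewrite Rabs_pos_eq; lra. }
    apply is_lim_seq_spec in HL. destruct (HL (mkposreal r Hr)) as [N0 HN0].
    exists N0. intros m. specialize (HN0 (S (N0 + m)) ltac:(lia)). simpl pos in HN0.
    rewrite Rminus_0_r in HN0. rewrite Cmod_mult, Cmod_pow.
    eapply Rle_trans; [apply Rle_abs|]. lra. }
  destruct HN as [N0 HN0].
  match goal with |- is_series ?u ?l => set (t := u); set (L := l) end.
  set (h := fun k => qpoch A q k * qpoch B q k
                     / (qpoch C1 q k * qpoch D q k * qpoch E q k)).
  set (f := fun N k => qpoch A q k / qpoch C1 q k * (qpoch B q k / qpoch D q k)
                     * (qpoch (alpha * Cpow q (S N)) q k / qpoch E q k)).
  assert (Hpartial : forall N, psum t (S N) * qpoch (alpha * q * x) q N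
                     = qpoch (alpha * q) q N * newton q (f N) x 0 (S N)).
  { intros N. rewrite (newton_ext q (f N)
      (fun k => qpoch (alpha * Cpow q (S N)) q k * h k)).
    - rewrite <- psum_very_well_poised by assumption. f_equal.
      apply psum_ext. intros n _. unfold t.
      rewrite phi43_dd by assumption.
      unfold x at 3. rewrite nodes_qpoch by assumption. fold x.
      assert (N1 := one_sub_ne_0 alpha Ha). assert (N2 := qpoch_q_ne_0 q n H1).
      assert (N3 := qpoch_ne_0 _ q n Hac).
      unfold h. field. repeat split; assumption.
    - intros k. unfold f, h. field.
      repeat split; now apply qpoch_ne_0. }
  assert (Hbound : forall m,
    (Cmod (ratio_inf q A C1 x * ratio_inf q B D x
           * ratio_inf q (alpha * Cpow q (S (N0 + m))) E x
           - newton q (f (N0 + m)%nat) x 0 (S (N0 + m)))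
     <= K * INR (S (S (N0 + m))) ^ 2 * (r * Cmod x) ^ S (N0 + m))%R).
  { intros m. exact (proj2 (HP2 _ _ _ _ _ _ HK12 HK3 HP1
                       (HB3 _ (HN0 m))) (S (N0 + m)) 0%nat). }
  (* Splitting [(alpha q; q)_oo] and [(alpha c; q)_oo] after [N] factors gives the product side the
     prefactor of the partial sum, times the value at [x] of the function interpolated there. *)
  assert (HL : forall N, L * qpoch (alpha * q * x) q N
    = qpoch (alpha * q) q N * (ratio_inf q A C1 x * ratio_inf q B D x
           * ratio_inf q (alpha * Cpow q (S N)) E x)).
  { intros N. unfold L, ratio_inf.
    rewrite (qpoch_inf_split (alpha * q) q N H1).
    replace (alpha * Cpow q (S N)) with (alpha * q * Cpow q N) by (simpl; ring).
    replace (alpha * q * Cpow q N * x) with (alpha * q * x * Cpow q N) by ring.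
    assert (N1 := qpoch_inf_ne_0 _ q H1 Hac).
    rewrite (qpoch_inf_split (alpha * q * x) q N H1) in N1 |- *.
    assert (N2 := qpoch_inf_ne_0 _ q H1 HC). assert (N3 := qpoch_inf_ne_0 _ q H1 HD).
    assert (N4 := qpoch_inf_ne_0 _ q H1 HE). assert (N5 := qpoch_inf_ne_0 _ q H1 HAx).
    assert (N6 := qpoch_inf_ne_0 _ q H1 HBx). assert (N7 := qpoch_ne_0 _ q N Hac).
    assert (N8 : qpoch_inf (alpha * q * x * Cpow q N) q <> 0)
      by (intros Z; apply N1; rewrite Z; ring).
    field. repeat split; assumption. }
  apply is_series_Clim. apply (Clim_shift _ _ (S N0)).
  apply Clim_le with (fun m => exp (Cmod (alpha * q) / (1 - Cmod q)) * Kc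
    * (K * (INR (S (S (N0 + m))) ^ 2 * (r * Cmod x) ^ S (N0 + m))))%R.
  - intros m. simpl Nat.add. set (N := (N0 + m)%nat) in *.
    assert (N7 := qpoch_ne_0 _ q N Hac).
    assert (Hup := Cmod_qpoch_le (alpha * q) q N H1).
    set (X := exp (Cmod (alpha * q) / (1 - Cmod q))) in *.
    (* Partial sum and limit share the factor [(alpha q; q)_N / (alpha c; q)_N], which is bounded in
       [N]; their difference is this factor times the interpolation error, up to sign. *)
    replace (psum t (S N) - L)
      with (- (qpoch (alpha * q) q N * / qpoch (alpha * q * x) q N
            * (ratio_inf q A C1 x * ratio_inf q B D x
               * ratio_inf q (alpha * Cpow q (S N)) E x
               - newton q (f N) x 0 (S N)))).
    + rewrite Cmod_opp, !Cmod_mult, Cmod_inv by assumption.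
      apply Rmult_le_compat; [|apply Cmod_ge_0| |].
      * apply Rmult_le_pos; [apply Cmod_ge_0|].
        now apply Rlt_le, Rinv_0_lt_compat, Cmod_gt_0.
      * apply Rmult_le_compat; [apply Cmod_ge_0| |exact Hup|apply HKc'].
        now apply Rlt_le, Rinv_0_lt_compat, Cmod_gt_0.
      * rewrite <- Rmult_assoc. apply Hbound.
    + apply (Cmult_reg_l (qpoch (alpha * q * x) q N)); [assumption|].
      transitivity (psum t (S N) * qpoch (alpha * q * x) q N
                    - L * qpoch (alpha * q * x) q N); [|ring].
      rewrite Hpartial, HL. field. assumption.
  - replace 0%R with (exp (Cmod (alpha * q) / (1 - Cmod q)) * Kc * (K * 0))%R by ring.
    apply is_lim_seq_mult'; [apply is_lim_seq_const|].
    apply is_lim_seq_mult'; [apply is_lim_seq_const|].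
    assert (Z : is_lim_seq (fun n => INR (S n) ^ 2 * (r * Cmod x) ^ n)%R 0%R).
    { apply is_lim_seq_poly_geom. split; [now apply Rmult_lt_0_compat | exact Hrx]. }
    apply (is_lim_seq_incr_n _ (S N0)) in Z.
    revert Z. apply is_lim_seq_ext. intros m.
    now replace (m + S N0)%nat with (S (N0 + m)) by lia.
Qed.
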